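(* Let $T>0$, $\alpha\in(0,1)$, $p>1/\alpha$, let $U,\rho,f,g$ satisfy assumptions (A1)-(A4) listed in the context, let $u(\cdot)\in\mathcal U^p[0,T]$ and let $x_0(\cdot)\in C([0,T];\mathbb R^n)$. Then the equation $$x(t)=x_0(t)+\int_0^t\frac{f(t,s,x(s),u(s))}{(t-s)^{1-\alpha}}\,\mathrm ds+\int_0^tg(t,s,x(s),u(s))\,\mathrm ds,\quad\text{a.e. }t\in[0,T],$$ admits a unique solution in $C([0,T];\mathbb R^n)$.
   Context: $\Delta:=\{(t,s)\in[0,T]^2:0\le s\le t\le T\}$. A modulus of continuity is an increasing function $\omega:[0,\infty)\to[0,\infty)$ vanishing at $0$ and continuous at $0$. $L^{q+}:=\bigcup_{r>q}L^r$ for $1\le q<\infty$. For a fixed $u_0\in U$, $\mathcal U^p[0,T]$ is the set of measurable $u:[0,T]\to U$ with $\rho(u(\cdot),u_0)\in L^p([0,T];\mathbb R_+)$. The functions $f,g:\Delta\times\mathbb R^n\times U\to\mathbb R^n$ are measurable so that the integrals are meaningful. (A1) $U\subset\mathbb R^d$ and $(U,\rho)$ is a separable metric space with $\rho(u,u')=|u-u'|$. (A2) There are a constant $K\ge0$ and a modulus of continuity $\omega$ with $|f(t,s,x,u)-f(t',s,x,u)|+|g(t,s,x,u)-g(t',s,x,u)|\le K\omega(|t-t'|)(1+|x|)$ for all $(t,s),(t',s)\in\Delta$, $x\in\mathbb R^n$, $u\in U$. (A3) $p>1/\alpha$ and there are nonnegative functions $K_0(\cdot)\in L^{\frac1\alpha+}([0,T];\mathbb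 R)$ and $K(\cdot)\in L^{\frac{p}{\alpha p-1}+}([0,T];\mathbb R)$ with $|f(t,s,x,u)-f(t,s,x',u')|+|g(t,s,x,u)-g(t,s,x',u')|\le K(s)(|x-x'|+\rho(u,u'))$ for all $(t,s)\in\Delta$, $x,x'\in\mathbb R^n$, $u,u'\in U$, and $|f(t,s,0,u)|+|g(t,s,0,u)|\le K_0(s)$ for all $(t,s)\in\Delta$, $u\in U$. (A4) $f$ and $g$ are of class $C^1$ in $x$, with derivatives $f_x,g_x$ bounded and continuous in $(x,u)\in\mathbb R^n\times U$. *)

(* Defs.v *)
From HB Require Import structures.
From mathcomp Require Import all_boot all_order all_algebra.
From mathcomp Require Import all_classical all_reals all_analysis.
From mathcomp Require Import measurable_realfun.

Set Implicit Arguments.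
Unset Strict Implicit.
Unset Printing Implicit Defensive.
Import Order.TTheory GRing.Theory Num.Theory.
Import numFieldNormedType.Exports.
Local Open Scope classical_set_scope.
Local Open Scope ring_scope.

(* The norm carried by 'rV[R]_n in the library is the sup norm. *)
Definition euclid_norm (R : realType) (n : nat) (x : 'rV[R]_n) : R :=
  Num.sqrt (\sum_(i < n) x 0 i ^+ 2).

(* The real line with its Lebesgue sigma-algebra, which is the domain of
   completed_lebesgue_measure; lebesgue_measure is restricted to Borel sets. *)
Notation lebesgue_line R :=
  (caratheodory_type (mu_ext (wlength (idfun : R -> R)))).

(* The real plane with its Lebesgue sigma-algebra: Borel sets completed by the
   negligible sets of the two-dimensional Lebesgue measure. *)
Notation lebesgue_plane R :=
  (g_sigma_algebraType (completed_algebra_gen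
     (lebesgue_measure \x lebesgue_measure : set (R * R) -> \bar R)%E)).

Notation borel_rV R n := (g_sigma_algebraType (@open 'rV[R]_n)).

(* Measurability on D for the trace on D of the sigma-algebra of the domain.
   Unlike measurable_fun D F, this is not vacuous when D is not measurable. *)
Definition trace_measurable_fun d1 d2
    (X : measurableType d1) (Y : measurableType d2) (D : set X) (F : X -> Y) :=
  preimage_set_system D F measurable `<=` preimage_set_system D idfun measurable.

Section Volterra.
Context (R : realType) (n d : nat) (T : R).
Implicit Types (U : set 'rV[R]_d) (rho : 'rV[R]_d -> 'rV[R]_d -> R).
Implicit Types (f g : R -> R -> 'rV[R]_n -> 'rV[R]_d -> 'rV[R]_n).
Implicit Types (x : R -> 'rV[R]_n) (u : R -> 'rV[R]_d).

Local Notation mu := (@completed_lebesgue_measure R).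
Local Notation enorm := (@euclid_norm R _).

Definition Delta (t s : R) : Prop := 0 <= s <= t /\ t <= T.

Definition modulus_of_continuity (omega : R -> R) : Prop :=
  [/\ forall r, 0 <= r -> 0 <= omega r,
      forall r r', 0 <= r -> r <= r' -> omega r <= omega r',
      omega 0 = 0
    & omega r @[r --> 0^'+] --> omega 0].

(* Only the values on [0, T] of the total functions below are relevant. *)
Definition Lp (q : R) (k : R -> R) : Prop :=
  (k \_ `[0, T] : lebesgue_line R -> R) \in Lfun mu q%:E.

Definition Lp_plus (q : R) (k : R -> R) : Prop := exists2 r, q < r & Lp r k.

Definition continuous_path x : Prop := {within `[0, T], continuous x}.

Definition control U rho (u0 : 'rV[R]_d) (p : R) u : Prop :=
  [/\ forall s, 0 <= s <= T -> U (u s),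
      measurable_fun (`[0, T] : set (lebesgue_line R))
        (u : lebesgue_line R -> borel_rV R d)
    & Lp p (fun s => rho (u s) u0)].

(* Measurability on Delta x R^n x U, for the product of the Lebesgue
   sigma-algebra of Delta and the Borel sigma-algebras of R^n and U. *)
Definition measurable_coef U f : Prop :=
  trace_measurable_fun
    ([set z | Delta z.1.1.1 z.1.1.2 /\ U z.2] :
       set (lebesgue_plane R * borel_rV R n * borel_rV R d))
    ((fun z => f z.1.1.1 z.1.1.2 z.1.2 z.2) :
       lebesgue_plane R * borel_rV R n * borel_rV R d -> borel_rV R n).

Definition A1 U rho : Prop :=
  (forall v v', U v -> U v' -> rho v v' = enorm (v - v')) /\
  (exists S : set 'rV[R]_d, [/\ S `<=` U, countable S &
     forall v e, U v -> 0 < e -> exists2 v', S v' & rho v v' < e]).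

Definition A2 U f g : Prop :=
  exists (K : R) (omega : R -> R),
  [/\ 0 <= K, modulus_of_continuity omega &
     forall t t' s y v, Delta t s -> Delta t' s -> U v ->
       enorm (f t s y v - f t' s y v) + enorm (g t s y v - g t' s y v)
         <= K * omega `|t - t'| * (1 + enorm y)].

Definition A3 U rho (alpha p : R) f g : Prop :=
  exists K0 K : R -> R,
  [/\ forall s, 0 <= s <= T -> 0 <= K0 s /\ 0 <= K s,
      Lp_plus (1 / alpha) K0,
      Lp_plus (p / (alpha * p - 1)) K,
      forall t s y y' v v', Delta t s -> U v -> U v' ->
        enorm (f t s y v - f t s y' v') + enorm (g t s y v - g t s y' v')
          <= K s * (enorm (y - y') + rho v v')
    & forall t s v, Delta t s -> U v ->
        enorm (f t s 0 v) + enorm (g t s 0 v) <= K0 s].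

(* The Jacobian is the matrix of the derivative in x; its boundedness does not
   depend on the norm chosen on matrices. *)
Definition C1_in_state U f : Prop :=
  forall t s, Delta t s ->
  [/\ forall y v, U v -> differentiable (fun z => f t s z v) y,
      exists M : R, forall y v, U v -> `|'J (fun z => f t s z v) y| <= M
    & {within [set yv | U yv.2],
        continuous (fun yv : 'rV[R]_n * 'rV[R]_d =>
          'J (fun z => f t s z yv.2) yv.1)}].

Definition A4 U f g : Prop := C1_in_state U f /\ C1_in_state U g.

Definition vintegrable (D : set R) (h : R -> 'rV[R]_n) : Prop :=
  forall i, mu.-integrable D (fun s => (h s 0 i)%:E).

Definition vintegral (D : set R) (h : R -> 'rV[R]_n) : 'rV[R]_n :=
  \row_i \int[mu]_(s in D) h s 0 i.

Definition solution (alpha : R) f g (x0 : R -> 'rV[R]_n) u x : Prop :=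
  let singular t s := ((t - s) `^ (1 - alpha))^-1 *: f t s (x s) (u s) in
  let regular t s := g t s (x s) (u s) in
  {ae mu, forall t, 0 <= t <= T ->
    [/\ vintegrable `[0, t] (singular t), vintegrable `[0, t] (regular t)
      & x t = x0 t + vintegral `[0, t] (singular t)
                   + vintegral `[0, t] (regular t)]}.

End Volterra.

(* Main.v *)
Require Import Defs.
From mathcomp Require Import all_boot all_order all_algebra.
From mathcomp Require Import all_classical all_reals all_analysis.
From mathcomp Require Import measurable_realfun ring lra.
Set Implicit Arguments.
Unset Strict Implicit.
Unset Printing Implicit Defensive.
Import Order.TTheory GRing.Theory Num.Theory.
Import numFieldNormedType.Exports.
Local Open Scope classical_set_scope.
Local Open Scope ring_scope.

(** The kernel estimate [sup_t int_0^t (t - s)^-(k + th) phi(s) ds < oo] holds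
    for some [th > 0], by Young's inequality, because [phi] lies in [L^q] with
    [q > 1 / (1 - k)].  This gain of a small exponent [th] does all the work:
    increments in [t] of the integral operator gain a factor [|t' - t|^th],
    whence continuity, and for the weighted norm [sup_t e^(-l t) |x t|] its
    Lipschitz constant gains a factor [l^-th], so that it is a contraction for
    large [l] and Picard iteration applies.  An equation satisfied almost
    everywhere by continuous paths holds everywhere, which gives uniqueness.
    Joint measurability for the completed plane only yields measurable sections
    for almost every [t]; continuity in [t] (A2) extends this to all [t]. *)

(** * The fractional kernel *)

(** The singular and the regular integral are instances of one operator, with kernel exponent
    [1 - alpha] and [0], so every estimate is made for a general exponent [k]. The coefficients
    enter only through the weight 1 + K_0 + K: K_0 carries the growth at state zero, K the Lipschitz
    factor, and 1 the time modulus of (A2), which comes without a weight in s. Both integrability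
    exponents supplied by (A3) exceed 1/alpha, because p / (alpha p - 1) = 1 / (alpha - 1/p); this
    is what leaves room for [th]. In the plain sup norm the operator would contract only on short
    intervals. The exponential weight spares the gluing of local solutions, which is awkward here
    since the memory of the kernel always reaches back to time 0. *)

Section Kernel.
Context {R : realType}.
Implicit Types (k q th t s l : R).

(** Cutting the kernel off at [s < t] lets integrals up to different times live on the single domain
    [0, T], so that they can be subtracted under one integral sign. *)
Definition kern k t s : R := if s < t then ((t - s) `^ k)^-1 else 0.

Lemma kern_ge0 k t s : 0 <= kern k t s.
Proof. by rewrite /kern; case: ifP => // _; rewrite invr_ge0 powR_ge0. Qed.

Lemma measurable_kern k t : measurable_fun [set: R] (kern k t).
Proof.
apply: measurable_fun_ifT => //.
  by apply: measurable_fun_ltr => //; exact: measurable_id.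
under eq_fun do rewrite -powRN.
apply: (measurableT_comp (measurable_powR (- k))).
by apply: measurable_funB => //; exact: measurable_id.
Qed.

(** Trading an exponent [th] of the singularity costs a factor c^th. With [c] the distance between
    two times this gives smallness, with [c := T] mere boundedness. *)
Lemma kernD_le k th t s c : 0 <= th -> s < t -> t - s <= c ->
  kern k t s <= c `^ th * kern (k + th) t s.
Proof.
move=> th0 st tsc; rewrite /kern st.
have a0 : 0 < t - s by rewrite subr_gt0.
rewrite powRD ?(gt_eqF a0) ?implybT// invfM mulrCA.
rewrite ler_peMr// ?invr_ge0 ?powR_ge0//.
rewrite ler_pdivlMr ?powR_gt0// mul1r ge0_ler_powR// ?nnegrE ltW//.
exact: lt_le_trans tsc.
Qed.

(** A Hoelder estimate in time. For [s < t], with a = t - s and b = t' - s, the difference factors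
    as a^-k (1 - (a/b)^k), so the increment enters only through the ratio a/b. *)
Lemma kern_sub_le k th t t' s : 0 <= k <= 1 -> 0 < th <= 1 -> t <= t' ->
  `|kern k t' s - kern k t s| <=
  (t' - t) `^ th * (kern (k + th) t' s + kern (k + th) t s).
Proof.
move=> /andP[k0 k1] /andP[th0 th1] tt'.
have [tt|neq] := eqVneq t' t.
  by rewrite tt !subrr normr0 powR0 ?mul0r// gt_eqF.
have d0 : 0 < t' - t by rewrite subr_gt0 lt_neqAle eq_sym neq.
(* For [t <= s < t'] only the later kernel is nonzero, and there [t' - s <= t' - t]. *)
have [st|ts] := ltP s t; last first.
  have -> : kern k t s = 0 by rewrite /kern ltNge ts.
  have -> : kern (k + th) t s = 0 by rewrite /kern ltNge ts.
  rewrite subr0 addr0 ger0_norm ?kern_ge0//.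
  have [st'|t's] := ltP s t'; last by rewrite /kern !ltNge t's/= mulr0.
  by apply: kernD_le => //; [exact: ltW|rewrite lerB].
have st' : s < t' by exact: lt_le_trans tt'.
apply: (@le_trans _ _ ((t' - t) `^ th * kern (k + th) t s)); last first.
  by rewrite ler_wpM2l ?powR_ge0// lerDr kern_ge0.
rewrite /kern st st'.
have a0 : 0 < t - s by rewrite subr_gt0.
have b0 : 0 < t' - s by rewrite subr_gt0.
have ab : t - s <= t' - s by rewrite lerB.
have -> : t' - t = (t' - s) - (t - s) by ring.
move: d0; have -> : t' - t = (t' - s) - (t - s) by ring.
move: (t - s) (t' - s) a0 b0 ab => a b a0 b0 ab d0.
have abk : a `^ k <= b `^ k by rewrite ge0_ler_powR// nnegrE ltW.
rewrite distrC ger0_norm; last by rewrite subr_ge0 lef_pV2 ?posrE ?powR_gt0.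
rewrite powRD ?(gt_eqF a0) ?implybT// invfM mulrCA.
have -> : (a `^ k)^-1 - (b `^ k)^-1 = (a `^ k)^-1 * (1 - (a / b) `^ k).
  rewrite powRM ?invr_ge0 ?ltW// mulrBr mulr1 mulrA mulVf ?gt_eqF ?powR_gt0//.
  by rewrite mul1r -[b^-1]powR_inv1 ?ltW// powRAC powR_inv1 ?powR_ge0.
rewrite ler_pM2l ?invr_gt0 ?powR_gt0//.
(* [1 - (a / b)^k <= 1 - a / b <= (1 - a / b)^th <= ((b - a) / a)^th] *)
apply: (@le_trans _ _ (1 - a / b)).
  rewrite lerB//; apply: ger1_powR => //.
  by rewrite divr_gt0//= ler_pdivrMr// mul1r.
have -> : 1 - a / b = (b - a) / b by rewrite mulrBl divff ?gt_eqF.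
apply: (@le_trans _ _ (((b - a) / b) `^ th)).
  apply: ger1_powR => //.
  by rewrite divr_gt0//= ler_pdivrMr// mul1r lerBlDr lerDl ltW.
rewrite powRM ?invr_ge0 ?(ltW b0) ?(ltW d0)// ler_pM2l ?powR_gt0//.
rewrite -[b^-1]powR_inv1 ?(ltW b0)// powRAC powR_inv1 ?powR_ge0//.
by rewrite lef_pV2 ?posrE ?powR_gt0// ge0_ler_powR// ?nnegrE ltW.
Qed.

(** The quotient of the exponentials is e^(-l(t - s)), at most (l(t - s))^-th. The kernel absorbs
    the power of [t - s], and l^-th remains as the contraction gain. *)
Lemma kern_expR_le k th l t s : 0 <= th <= 1 -> 0 < l ->
  kern k t s * expR (l * s) <=
  expR (l * t) * (l `^ th)^-1 * kern (k + th) t s.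
Proof.
move=> /andP[th0 th1] l0; rewrite /kern; case: ifPn => [st|_]; last first.
  by rewrite mul0r mulr0.
have a0 : 0 < t - s by rewrite subr_gt0.
have -> : l * s = l * t - l * (t - s) by ring.
rewrite expRD expRN; move: (t - s) a0 => a a0.
rewrite powRD ?(gt_eqF a0) ?implybT// mulrCA -mulrA ler_pM2l ?expR_gt0//.
rewrite invfM mulrCA ler_pM2l ?invr_gt0 ?powR_gt0// -invfM -powRM ?(ltW l0) ?(ltW a0)//.
rewrite lef_pV2 ?posrE ?powR_gt0 ?expR_gt0 ?mulr_gt0//.
(* [x^th <= 1 + x <= e^x] with [x = l * a] *)
apply: (@le_trans _ _ (1 + l * a)); last exact: expR_ge1Dx.
have la0 : 0 < l * a by rewrite mulr_gt0.
have [la1|la1] := leP (l * a) 1.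
  apply: (@le_trans _ _ 1); last by rewrite lerDl ltW.
  have <- : 1 `^ th = 1 :> R by rewrite powR1.
  by rewrite ge0_ler_powR// nnegrE// ltW.
by apply: (@le_trans _ _ (l * a)); [apply: ler1_powR => //; exact: ltW|rewrite lerDr].
Qed.

Lemma kern_powR k q t s : 0 < q -> kern k t s `^ q = kern (k * q) t s.
Proof.
move=> q0; rewrite /kern; case: ifPn => [st|_]; last by rewrite powR0 ?gt_eqF.
rewrite -powR_inv1 ?powR_ge0// powRAC powR_inv1 ?powR_ge0//.
by rewrite powRrM.
Qed.

End Kernel.

(** * Integrals of the kernel for the completed Lebesgue measure *)

Section Lebesgue.
Context {R : realType}.
Implicit Types (k q th t s l T : R).
Local Notation mu := (@completed_lebesgue_measure R).
Local Notation leb := (@lebesgue_measure R).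
Local Notation LL := (lebesgue_line R).

Lemma borel_lebesgue (A : set R) :
  measurable (A : set (measurableTypeR R)) -> measurable (A : set LL).
Proof. exact: sub_caratheodory. Qed.

Lemma measurable_id_line :
  measurable_fun [set: LL] (idfun : LL -> measurableTypeR R).
Proof. by move=> _ Y mY; rewrite setTI; exact: borel_lebesgue. Qed.

Lemma measurable_fun_line d (Y : measurableType d) (D : set R) (f : R -> Y) :
  measurable (D : set (measurableTypeR R)) ->
  measurable_fun (D : set (measurableTypeR R)) f ->
  measurable_fun (D : set LL) (f : LL -> Y).
Proof. by move=> mD mf _ B mB; apply: borel_lebesgue; exact: mf. Qed.

(** The identity pushes the completed measure forward to Lebesgue measure on Borel sets. The kernel
    integral can then be evaluated by the fundamental theorem of calculus for [lebesgue_measure]. *)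
Lemma ge0_integral_completed (D : set R) (f : R -> \bar R) :
  measurable (D : set (measurableTypeR R)) ->
  measurable_fun (D : set (measurableTypeR R)) f ->
  (forall x, D x -> 0 <= f x)%E ->
  (\int[mu]_(x in D) f x = \int[leb]_(x in D) f x)%E.
Proof.
move=> mD mf f0.
have f0' : {in D, forall y, 0 <= f y}%E by move=> x /[!inE]; exact: f0.
have H := ge0_integral_pushforward measurable_id_line mu mD mf f0'.
apply: etrans (esym H) _.
by apply: eq_measure_integral => [|mid A _ _ //]; exact: measurable_id_line.
Qed.

Lemma is_derive_powR_sub t k s : s < t ->
  is_derive s 1 (fun s => (t - s) `^ k) (- (k * (t - s) `^ (k - 1))).
Proof.
move=> st.
have ts0 : 0 < t - s by rewrite subr_gt0.
have d1 : is_derive s 1 (fun s : R => t - s) (-1).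
  by apply: is_derive_eq; rewrite add0r mul1r.
have d2 := is_derive1_powR k ts0.
have := @is_derive1_comp _ (@powR R ^~ k) (fun s => t - s) s _ _ d2 d1.
by rewrite mulrN1.
Qed.

Lemma integral_powR_le k t a b : k < 1 -> a < b -> b < t ->
  (\int[leb]_(s in `[a, b]) ((t - s) `^ (- k))%:E <=
     ((t - a) `^ (1 - k) / (1 - k))%:E)%E.
Proof.
move=> k1 ab bt.
have k10 : 0 < 1 - k by rewrite subr_gt0.
(* Antiderivative of (t - s)^-k; its value at [b] is nonpositive and is dropped from the bound. *)
pose F s := - ((t - s) `^ (1 - k) / (1 - k)).
have dF s : s < t -> is_derive s 1 F ((t - s) `^ (- k)).
  move=> st; have := is_derive_powR_sub (1 - k) st => h.
  have -> : F = - (1 - k)^-1 \*: (fun s => (t - s) `^ (1 - k)).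
    by apply/funext => x; rewrite /F /= mulrC -mulNr.
  have h' := is_deriveZ (- (1 - k)^-1) h.
  apply: (is_derive_eq h').
  rewrite /GRing.scale/= mulrNN mulrA mulVf ?gt_eqF// mul1r.
  by congr (_ `^ _); ring.
have cF s : s < t -> {for s, continuous F}.
  move=> /dF [dF' _]; apply: differentiable_continuous.
  exact/derivable1_diffP.
rewrite (@continuous_FTC2 _ _ F)//.
- rewrite -EFinB lee_fin /F opprK addrC lerBlDr lerDl.
  by rewrite divr_ge0 ?powR_ge0// ltW.
- apply: continuous_in_subspaceT => s; rewrite inE/= in_itv/= => /andP[_ sb].
  have [+ _] := is_derive_powR_sub (- k) (le_lt_trans sb bt).
  by move=> d; apply: differentiable_continuous; exact/derivable1_diffP.
- split.
  + by move=> s; rewrite in_itv/= => /andP[_ sb]; have [] := dF s (lt_trans sb bt).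
  + by apply: cvg_at_right_filter; apply: cF; exact: lt_trans bt.
  + by apply: cvg_at_left_filter; exact: cF.
- move=> s; rewrite in_itv/= => /andP[_ sb].
  by rewrite derive1E; have [_ ->] := dF s (lt_trans sb bt).
Qed.

(** The fundamental theorem does not reach the singular endpoint [t]. The intervals [0, t - 1/(n+1)]
    avoid it with a bound uniform in n, and monotone convergence passes to the limit. *)
Lemma kern_integral_le k T t : k < 1 -> 0 <= t <= T ->
  (\int[mu]_(s in `[0%R, T]) (kern k t s)%:E <= (T `^ (1 - k) / (1 - k))%:E)%E.
Proof.
move=> k1 /andP[t0 tT].
have k10 : 0 < 1 - k by rewrite subr_gt0.
have C0 : 0 <= T `^ (1 - k) / (1 - k) by rewrite divr_ge0 ?powR_ge0// ltW.
have mk (D : set R) : measurable_fun (D : set (measurableTypeR R))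
    (fun s => (kern k t s)%:E).
  apply/measurable_EFinP.
  exact: measurable_funS (measurable_kern k t).
have k0 s : (0 <= (kern k t s)%:E)%E by rewrite lee_fin kern_ge0.
rewrite ge0_integral_completed//.
pose A n : set (measurableTypeR R) := `[0, t - n.+1%:R^-1]%classic.
have mA n : measurable (A n : set (measurableTypeR R)) by exact: measurable_itv.
have AU : \bigcup_n A n = `[0, t[%classic.
  apply/seteqP; split => [s [n _]|s]; rewrite /A /= !in_itv/= => /andP[s0].
    by move=> st; rewrite s0/= (le_lt_trans st)// ltrBlDr ltrDl invr_gt0.
  move=> st; have [n h] := ltr_add_invr st.
  by exists n => //=; rewrite in_itv/= s0/= lerBrDr ltW.
have -> : (\int[leb]_(s in `[0%R, T]) (kern k t s)%:E =
           \int[leb]_(s in \bigcup_n A n) (kern k t s)%:E)%E.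
  rewrite AU integral_mkcond [RHS]integral_mkcond; apply: eq_integral => s _.
  rewrite /patch !mem_setE !in_itv/=; have [st|ts] := ltP s t.
    by rewrite (le_trans (ltW st) tT).
  by rewrite andbF /kern ltNge ts; case: ifP.
have ndA : nondecreasing_seq A.
  move=> m n mn; apply/subsetPset => s; rewrite /A/= !in_itv/= => /andP[-> h]/=.
  by rewrite (le_trans h)// lerB// lef_pV2 ?posrE// ler_nat ltnS.
have cv := @ge0_nondecreasing_set_cvg_integral _ _ _ A _ leb
  ndA mA (fun i => mk (A i)) (fun i s _ => k0 s).
apply: cvge_le cv.
apply: nearW => n.
(* For small n the interval is empty or the single point 0, and contributes nothing. *)
have [tn|tn] := leP (t - n.+1%:R^-1) 0.
  apply: (@le_trans _ _ 0%E); last by rewrite lee_fin.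
  rewrite le_eqVlt; apply/orP; left; apply/eqP.
  move: tn; rewrite le_eqVlt => /predU1P[tn|tn].
    by rewrite /A tn set_itv1 integral_set1.
  by rewrite /A set_itv_ge ?integral_set0// bnd_simp -ltNge.
have lt_t : t - n.+1%:R^-1 < t by rewrite ltrBlDr ltrDl invr_gt0.
apply: le_trans (le_trans (integral_powR_le k1 tn lt_t) _).
  apply: ge0_le_integral => //.
  - apply/measurable_EFinP; apply: measurable_funTS.
    apply: (measurableT_comp (measurable_powR (- k))).
    by apply: measurable_funB => //; exact: measurable_id.
  - move=> s; rewrite /A /= in_itv/= => /andP[_ st].
    by rewrite /kern (le_lt_trans st lt_t) powRN.
rewrite lee_fin subr0 ler_pM2r ?invr_gt0// ge0_ler_powR// ?nnegrE//.
  exact: ltW.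
exact: le_trans tT.
Qed.

End Lebesgue.

(** * Volterra integrals *)

Section Domination.
Context d (X : measurableType d) (R : realType) (mu : {measure set X -> \bar R}).
Variables (D : set X) (W : X -> R) (m : R).
Hypotheses (mD : measurable D) (mW : measurable_fun D W)
  (W0 : forall x, D x -> 0 <= W x)
  (iW : (\int[mu]_(x in D) (W x)%:E <= m%:E)%E).

Lemma integrable_ge0_le : mu.-integrable D (EFin \o W).
Proof.
apply/integrableP; split; first exact/measurable_EFinP.
apply: le_lt_trans (ltry m); apply: le_trans iW.
rewrite le_eqVlt; apply/orP; left; apply/eqP.
by apply: eq_integral => x /[!inE] Dx /=; rewrite ger0_norm ?W0.
Qed.

Lemma integrable_le (f : X -> R) : measurable_fun D f ->
  (forall x, D x -> `|f x| <= W x) -> mu.-integrable D (EFin \o f).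
Proof.
move=> mf fW; apply: (le_integrable mD) integrable_ge0_le.
  exact/measurable_EFinP.
by move=> x Dx /=; rewrite lee_fin (le_trans (fW _ Dx))// ler_norm.
Qed.

(** Shared by the continuity and the contraction estimate, each of which thereby reduces to a
    pointwise majorant. *)
Lemma Rintegral_dist_le (f1 f2 : X -> R) :
  mu.-integrable D (EFin \o f1) -> mu.-integrable D (EFin \o f2) ->
  (forall x, D x -> `|f1 x - f2 x| <= W x) ->
  `|\int[mu]_(x in D) f1 x - \int[mu]_(x in D) f2 x| <= m.
Proof.
move=> if1 if2 fW; rewrite -RintegralB//.
have if12 : mu.-integrable D (EFin \o (fun x => f1 x - f2 x)).
  exact: (integrableB mD if1 if2).
apply: le_trans (le_normr_Rintegral mD if12) _.
apply: (@le_trans _ _ (\int[mu]_(x in D) W x)).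
  apply: le_Rintegral => //; last exact: integrable_ge0_le.
  exact: (integrable_abse if12).
rewrite -lee_fin /Rintegral fineK//.
exact: integrable_fin_num integrable_ge0_le.
Qed.

End Domination.

Section Volterra.
Context {R : realType}.
Local Notation mu := (@completed_lebesgue_measure R).
Local Notation LL := (lebesgue_line R).
Implicit Types (T k q th t s l c : R).

Lemma measurable_itv_line (i : interval R) : measurable ([set` i] : set LL).
Proof. by apply: borel_lebesgue; exact: measurable_itv. Qed.

Lemma measurable_kern_line k t (D : set LL) : measurable_fun D (kern k t : LL -> R).
Proof.
apply: measurable_funTS.
by apply: measurable_fun_line => //; exact: measurable_kern.
Qed.

Lemma Lp_measurable T q (phi : R -> R) : Lp T q phi ->
  measurable_fun (`[0, T]%classic : set LL) (phi : LL -> R).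
Proof.
move=> /andP[/[!inE] mphi _].
have := measurable_funS measurableT (@subsetT _ (`[0, T]%classic : set LL)) mphi.
by apply: eq_measurable_fun => s sI; rewrite patchT.
Qed.

(** Young's inequality separates a power of the kernel, whose integral is bounded uniformly in [t],
    from the q-th power of [phi], whose integral does not depend on [t]. The factors 1/p and 1/q are
    at most 1 and are dropped. *)
Lemma kern_Lp_bound T k q (phi : R -> R) : 0 <= T -> 0 <= k -> 1 < q ->
  k < 1 - q^-1 -> Lp T q phi -> (forall s, 0 <= s <= T -> 0 <= phi s) ->
  exists2 th0, 0 < th0 & forall th, 0 < th <= th0 ->
  exists M, forall t, 0 <= t <= T ->
    (\int[mu]_(s in `[0%R, T]) (kern (k + th) t s * phi s)%:E <= M%:E)%E.
Proof.
move=> T0 k0 q1 kq Lphi phi0.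
have q0 : 0 < q by exact: lt_trans q1.
have iq0 : 0 < q^-1 by rewrite invr_gt0.
have iq1 : q^-1 < 1 by rewrite invf_lt1.
have mphi := Lp_measurable Lphi.
(* [p] is the exponent conjugate to [q]; the kernel to the power [p] stays
   integrable as long as [(k + th) * p < 1]. *)
pose p := (1 - q^-1)^-1.
have p0 : 0 < p by rewrite invr_gt0 subr_gt0.
have pq : p^-1 + q^-1 = 1 by rewrite /p invrK subrK.
(* Half of the gap, so that [k + th] stays strictly below 1 - 1/q = 1/p. *)
exists ((1 - q^-1 - k) / 2); first by rewrite divr_gt0// subr_gt0.
move=> th /andP[th0 th1].
have kp : (k + th) * p < 1.
  by rewrite -ltr_pdivlMr// mul1r -[ltRHS]invrK invrK /p invrK; lra.
have iphi := Lfun_integrable (ltW q1) Lphi.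
pose c := fine (\int[mu]_s (`|((phi \_ `[0, T]) s)| `^ q)%:E)%E.
exists (T `^ (1 - (k + th) * p) / (1 - (k + th) * p) + c) => t tT.
have mI := measurable_itv_line `[0, T].
have mphiq : measurable_fun setT (fun s : LL => (`|((phi \_ `[0, T]) s)| `^ q)%:E).
  exact: measurable_int iphi.
rewrite EFinD; apply: (@le_trans _ _
  (\int[mu]_(s in `[0%R, T]) (kern ((k + th) * p) t s +
     `|((phi \_ `[0%R, T]) s)| `^ q)%:E)%E).
  apply: ge0_le_integral; first exact: mI.
  - by move=> s sI; rewrite lee_fin mulr_ge0 ?kern_ge0 ?phi0.
  - apply/measurable_EFinP; apply: measurable_funM => //.
    exact: measurable_kern_line.
  - apply/measurable_EFinP; apply: measurable_funD.
      exact: measurable_kern_line.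
    by apply: measurable_funTS; exact/measurable_EFinP.
  - move=> s sI; rewrite lee_fin patchT ?inE//.
    rewrite ger0_norm ?phi0//.
    apply: le_trans (conjugate_powR (kern_ge0 _ _ _) (phi0 _ sI) p0 q0 pq) _.
    rewrite lerD ?ler_piMr ?powR_ge0// ?(ltW iq1)//.
    rewrite kern_powR// ler_piMr ?kern_ge0//.
    by rewrite -[leRHS]pq lerDl ltW.
under eq_integral do rewrite EFinD.
rewrite (ge0_integralD _ mI); last 4 first.
- by move=> s _; rewrite lee_fin kern_ge0.
- by apply/measurable_EFinP; exact: measurable_kern_line.
- by move=> s _; rewrite lee_fin powR_ge0.
- exact: measurable_funTS.
apply: leeD; first exact: kern_integral_le.
rewrite /c fineK; last exact: integrable_fin_num.
by apply: ge0_subset_integral => // s _; rewrite lee_fin powR_ge0.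
Qed.

Variables (T k th M : R) (phi : R -> R).
Hypotheses (k01 : 0 <= k <= 1) (th01 : 0 < th <= 1)
  (mphi : measurable_fun (`[0, T]%classic : set LL) (phi : LL -> R))
  (phi0 : forall s, 0 <= s <= T -> 0 <= phi s)
  (hM : forall t, 0 <= t <= T ->
    (\int[mu]_(s in `[0%R, T]) (kern (k + th) t s * phi s)%:E <= M%:E)%E).

Let mI := measurable_itv_line `[0, T].
Let w t s := kern (k + th) t s * phi s.

Let w_ge0 t s : `[0, T]%classic s -> 0 <= w t s.
Proof. by move=> sI; rewrite mulr_ge0 ?kern_ge0 ?phi0. Qed.

Let measurable_w t : measurable_fun (`[0, T]%classic : set LL) (w t : LL -> R).
Proof. by apply: measurable_funM => //; exact: measurable_kern_line. Qed.

Let integral_Zw c t : 0 <= t <= T -> 0 <= c ->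
  (\int[mu]_(s in `[0%R, T]) (c * w t s)%:E <= (c * M)%:E)%E.
Proof.
move=> tT c0; under eq_integral do rewrite EFinM.
rewrite (ge0_integralZl _ mI); last 3 first.
- exact/measurable_EFinP.
- by move=> s sI; rewrite lee_fin w_ge0.
- by rewrite lee_fin.
by rewrite EFinM lee_wpmul2l ?lee_fin// hM.
Qed.

Definition volterra (h : R -> R -> R) t : R :=
  \int[mu]_(s in `[0, T]) (kern k t s * h t s).

(** Measurability is requested only of the truncation to [s < t], since the coefficients are
    controlled only on [Delta]; the kernel kills the rest. The majorant is [kernD_le] with
    [t - s <= T]. *)
Lemma kern_mul_integrable t c (h : R -> R) : 0 <= t <= T -> 0 <= c ->
  measurable_fun (`[0, T]%classic : set LL)
    (fun s : LL => if s < t then h s else 0) ->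
  (forall s, 0 <= s < t -> `|h s| <= c * phi s) ->
  mu.-integrable (`[0, T]%classic : set LL)
    (EFin \o (fun s : LL => kern k t s * h s)).
Proof.
move=> /[dup] tT /andP[t0 tT'] c0 mh hc.
have Tc0 : 0 <= T `^ th * c by rewrite mulr_ge0 ?powR_ge0.
apply: (@integrable_le _ _ _ mu _ (fun s => T `^ th * c * w t s) _ mI).
- exact: measurable_funM.
- by move=> s sI; rewrite mulr_ge0 ?w_ge0.
- exact: integral_Zw.
- have : measurable_fun (`[0, T]%classic : set LL)
      (fun s : LL => kern k t s * if s < t then h s else 0).
    by apply: measurable_funM => //; exact: measurable_kern_line.
  apply: eq_measurable_fun => s _.
  by rewrite /kern; case: ifP => //; rewrite !mul0r.
- move=> s; rewrite /= in_itv/= => /andP[s0 sT].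
  rewrite normrM ger0_norm ?kern_ge0//.
  have [st|ts] := ltP s t; last first.
    by rewrite /kern ltNge ts/= mul0r mulr_ge0// w_ge0//= in_itv/= s0.
  rewrite (_ : _ * w t s = (T `^ th * kern (k + th) t s) * (c * phi s)); last first.
    by rewrite /w; ring.
  apply: ler_pM => //; rewrite ?kern_ge0 ?hc ?s0//.
  apply: kernD_le => //; first by case/andP: th01 => /ltW.
  by rewrite lerBlDr (le_trans tT')// lerDl.
Qed.

(** Two effects add up: the kernel moves, at the price (t' - t)^th of [kern_sub_le], and the
    integrand moves, at the price [b] against the kernel at [t]. *)
Lemma volterra_increment_le t t' c b (h : R -> R -> R) :
  0 <= t -> t <= t' -> t' <= T -> 0 <= c -> 0 <= b ->
  (forall r, 0 <= r <= T -> measurable_fun (`[0, T]%classic : set LL)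
    (fun s : LL => if s < r then h r s else 0)) ->
  (forall r s, 0 <= s < r -> r <= T -> `|h r s| <= c * phi s) ->
  (forall s, 0 <= s < t -> `|h t' s - h t s| <= b * phi s) ->
  `|volterra h t' - volterra h t| <=
    (t' - t) `^ th * c * M + ((t' - t) `^ th * c + T `^ th * b) * M.
Proof.
move=> t0 tt' t'T c0 b0 mh hc hb.
have tT : 0 <= t <= T by rewrite t0 (le_trans tt').
have t'T' : 0 <= t' <= T by rewrite t'T (le_trans t0).
have dc0 : 0 <= (t' - t) `^ th * c by rewrite mulr_ge0 ?powR_ge0.
have e0 : 0 <= (t' - t) `^ th * c + T `^ th * b.
  by rewrite addr_ge0// mulr_ge0 ?powR_ge0.
apply: (@Rintegral_dist_le _ _ _ mu _ (fun s => (t' - t) `^ th * c * w t' s +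
  ((t' - t) `^ th * c + T `^ th * b) * w t s) _ mI).
- by apply: measurable_funD; exact: measurable_funM.
- by move=> s sI; rewrite addr_ge0// mulr_ge0// w_ge0.
- under eq_integral do rewrite EFinD.
  rewrite (ge0_integralD _ mI); last 4 first.
  + by move=> s sI; rewrite lee_fin mulr_ge0// w_ge0.
  + by apply/measurable_EFinP; exact: measurable_funM.
  + by move=> s sI; rewrite lee_fin mulr_ge0// w_ge0.
  + by apply/measurable_EFinP; exact: measurable_funM.
  by rewrite EFinD leeD// integral_Zw.
- by apply: (kern_mul_integrable t'T' c0 (mh _ t'T')) => s /hc; exact.
- apply: (kern_mul_integrable tT c0 (mh _ tT)) => s /hc; apply.
  by case/andP: tT.
- move=> s; rewrite /= in_itv/= => /andP[s0 sT].
  (* The kernel difference must carry [h t']: for [t <= s < t'] it is nonzero while [h t s] is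
     uncontrolled. The increment of [h] is then multiplied by [kern k t s], which vanishes there. *)
  have -> : kern k t' s * h t' s - kern k t s * h t s =
      (kern k t' s - kern k t s) * h t' s + kern k t s * (h t' s - h t s).
    by ring.
  have -> : (t' - t) `^ th * c * w t' s +
      ((t' - t) `^ th * c + T `^ th * b) * w t s =
      (t' - t) `^ th * (kern (k + th) t' s + kern (k + th) t s) * (c * phi s) +
      T `^ th * kern (k + th) t s * (b * phi s).
    by rewrite /w; ring.
  apply: le_trans (ler_normD _ _) _; rewrite !normrM; apply: lerD.
  + have [st|ts] := ltP s t'; last first.
      rewrite /kern !ltNge ts (le_trans tt' ts)/=.
      by rewrite subrr normr0 mul0r addr0 mulr0 mul0r.
    apply: ler_pM => //; last by apply: hc => //; rewrite s0.
    exact: kern_sub_le.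
  + rewrite [`|kern _ _ _|]ger0_norm ?kern_ge0//.
    have [st|ts] := ltP s t; last by rewrite /kern ltNge ts/= mulr0 !mul0r.
    apply: ler_pM => //; rewrite ?kern_ge0 ?hb ?s0//.
    apply: kernD_le => //; first by case/andP: th01 => /ltW.
    by rewrite lerBlDr (le_trans (le_trans tt' t'T))// lerDl.
Qed.

(** Under the integral, [kern_expR_le] moves the exponential from [s] to [t] and leaves l^-th. The
    bound [c'] secures integrability of the two terms; the rate is governed by [c]. *)
Lemma volterra_contraction l t c c' (h1 h2 : R -> R -> R) :
  0 <= t <= T -> 0 <= c -> 0 <= c' -> 0 < l ->
  measurable_fun (`[0, T]%classic : set LL)
    (fun s : LL => if s < t then h1 t s else 0) ->
  measurable_fun (`[0, T]%classic : set LL)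
    (fun s : LL => if s < t then h2 t s else 0) ->
  (forall s, 0 <= s < t -> `|h1 t s| <= c' * phi s) ->
  (forall s, 0 <= s < t -> `|h2 t s| <= c' * phi s) ->
  (forall s, 0 <= s < t -> `|h1 t s - h2 t s| <= c * expR (l * s) * phi s) ->
  `|volterra h1 t - volterra h2 t| <= c * (expR (l * t) * (l `^ th)^-1) * M.
Proof.
move=> tT c0 c'0 l0 m1 m2 h1c h2c h12.
have e0 : 0 <= c * (expR (l * t) * (l `^ th)^-1).
  by rewrite !mulr_ge0 ?expR_ge0 ?invr_ge0 ?powR_ge0.
apply: (@Rintegral_dist_le _ _ _ mu _ (fun s =>
   c * (expR (l * t) * (l `^ th)^-1) * w t s) _ mI).
- exact: measurable_funM.
- by move=> s sI; rewrite mulr_ge0 ?w_ge0.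
- exact: integral_Zw.
- exact: kern_mul_integrable tT c'0 m1 h1c.
- exact: kern_mul_integrable tT c'0 m2 h2c.
- move=> s; rewrite /= in_itv/= => /andP[s0 sT].
  rewrite -mulrBr normrM ger0_norm ?kern_ge0//.
  have [st|ts] := ltP s t; last first.
    by rewrite /kern ltNge ts/= mul0r mulr_ge0// w_ge0//= in_itv/= s0.
  apply: (@le_trans _ _ (kern k t s * (c * expR (l * s) * phi s))).
    by rewrite ler_wpM2l ?kern_ge0// h12// s0.
  have -> : kern k t s * (c * expR (l * s) * phi s) =
    c * phi s * (kern k t s * expR (l * s)) by ring.
  have -> : c * (expR (l * t) / l `^ th) * w t s =
    c * phi s * (expR (l * t) / l `^ th * kern (k + th) t s).
    by rewrite /w; ring.
  rewrite ler_wpM2l ?mulr_ge0 ?phi0 ?s0// kern_expR_le//.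
  by case/andP: th01 => /ltW ->.
Qed.

End Volterra.

(** * Measurability along a path *)

Section CountableAe.
Context d (X : measurableType d) (R : realType) (mu : {measure set X -> \bar R}).

Lemma ae_forall_count (I : countType) (P : I -> X -> Prop) :
  (forall i, {ae mu, forall x, P i x}) -> {ae mu, forall x, forall i, P i x}.
Proof.
move=> aeP.
have neg (m : nat) : mu.-negligible
    (if unpickle m is Some i then ~` [set x | P i x] else set0).
  by case: (unpickle m) => [i|]; [exact: aeP|exact: negligible_set0].
apply: negligibleS (negligible_bigcup neg) => x /= /existsNP[i nPi].
by exists (pickle i) => //; rewrite pickleK.
Qed.

Lemma ae_imp (P Q : X -> Prop) : (forall x, P x -> Q x) ->
  {ae mu, forall x, P x} -> {ae mu, forall x, Q x}.
Proof. by move=> PQ; apply: negligibleS => x nQ /PQ. Qed.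

End CountableAe.

(** * Sections of sets measurable for the completed plane *)

Section Sections.
Context {R : realType}.
Local Notation mu := (@completed_lebesgue_measure R).
Local Notation leb := (@lebesgue_measure R).
Local Notation LL := (lebesgue_line R).

Lemma negligible_lebesgue_line (N : set R) : leb.-negligible N -> mu.-negligible N.
Proof. by move=> [A [mA A0 NA]]; exists A; split => //; exact: borel_lebesgue. Qed.

(** The place where completeness of the line enters: null sections of a negligible planar set need
    not be Borel. *)
Lemma measurable_negligible_line (N : set R) :
  leb.-negligible N -> measurable (N : set LL).
Proof.
by move=> /negligible_lebesgue_line; exact: completed_lebesgue_measure_is_complete.
Qed.

(** A null set cannot contain an interval of positive length; so the good times are dense. *)
Lemma ae_itvoo (P : R -> Prop) a b : {ae mu, forall t, P t} -> a < b ->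
  exists2 t, a < t < b & P t.
Proof.
move=> [N [mN N0 PN]] ab; apply: contrapT => nP.
have abN : `]a, b[%classic `<=` N.
  move=> t; rewrite /= in_itv/= => tab; apply: PN => Pt; apply: nP.
  by exists t.
have : (mu (`]a, b[%classic : set LL) <= mu N)%E.
  by apply: le_measure; rewrite ?inE//; exact: measurable_itv_line.
rewrite N0 (_ : mu `]a, b[%classic = leb `]a, b[%classic)//.
by rewrite lebesgue_measure_itv/= lte_fin ab -EFinB lee_fin subr_le0 leNgt ab.
Qed.

(** The measure of a Borel null cover is the integral of the measures of its sections; a nonnegative
    function with zero integral vanishes almost everywhere. *)
Lemma ae_section_negligible (Z : set (R * R)) :
  (leb \x leb)%E.-negligible Z -> {ae leb, forall t, leb.-negligible (xsection Z t)}.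
Proof.
move=> [B [mB B0 ZB]].
have : ae_eq leb [set: R] (leb \o xsection B) (cst 0%E).
  apply/(ae_eq_integral_abs leb measurableT).
    exact: measurable_fun_xsection.
  rewrite -[RHS]B0 /product_measure1; apply: eq_integral => t _.
  by rewrite gee0_abs.
apply: ae_imp => t /(_ I) B0t.
exists (xsection B t); split => //; first exact: measurable_xsection.
exact: le_xsection.
Qed.

(* The sections are controlled only for almost every [t], since a null set of the
   plane may have non-measurable exceptional sections. *)
Lemma sigma_algebra_ae_section (Y : Type) (psi : R -> R -> Y) (I : set LL) :
  measurable I ->
  sigma_algebra [set: Y] [set E | {ae leb, forall t, measurable (I `&` psi t @^-1` E)}].
Proof.
move=> mI; split => /=.
- by apply: nearW => t; rewrite preimage_set0 setI0.
- move=> E; apply: ae_imp => t mE.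
  rewrite (_ : _ `&` _ = I `\` (I `&` psi t @^-1` E)); first exact: measurableD.
  by rewrite setDIr setDv set0U setTD preimage_setC setDE.
- move=> E mE; apply: ae_imp (ae_forall_count mE) => t mEt.
  by rewrite preimage_bigcup setI_bigcupr; exact: bigcupT_measurable.
Qed.

(** The good sets form a sigma-algebra, so it suffices to test the cylinders that generate the
    product. *)
Lemma ae_section_prod d1 d2 (Y1 : measurableType d1) (Y2 : measurableType d2)
    (psi : R -> R -> Y1 * Y2) (I : set LL) (E : set (Y1 * Y2)) :
  measurable I ->
  (forall A, measurable A ->
    {ae leb, forall t, measurable (I `&` (fst \o psi t) @^-1` A)}) ->
  (forall A, measurable A ->
    {ae leb, forall t, measurable (I `&` (snd \o psi t) @^-1` A)}) ->
  measurable E ->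
  {ae leb, forall t, measurable (I `&` psi t @^-1` E)}.
Proof.
move=> mI h1 h2; move: E; apply: smallest_sub.
  exact: sigma_algebra_ae_section.
move=> E [] [A mA <-]; rewrite setTI; [exact: h1|exact: h2].
Qed.

(** The generators are unions of a Borel set, all of whose sections are Borel, and a negligible set,
    almost all of whose sections are null and hence measurable by completeness. *)
Lemma ae_section_plane (I : set LL) (E : set (lebesgue_plane R)) :
  measurable I -> measurable E ->
  {ae leb, forall t, measurable (I `&` (pair t) @^-1` E)}.
Proof.
move=> mI; move: E; apply: smallest_sub.
  exact: (@sigma_algebra_ae_section _ (fun t s => (t, s))).
move=> _ /= [B mB [N negN <-]].
apply: ae_imp (ae_section_negligible negN) => t negNt.
rewrite preimage_setU setIUr; apply: measurableU; apply: measurableI => //.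
  have := measurable_xsection t mB.
  by move=> /borel_lebesgue; rewrite xsectionE.
by move/measurable_negligible_line : negNt; rewrite xsectionE.
Qed.

(** Only the planar coordinate produces exceptional times: the preimages under [x] and [u] do not
    depend on [t]. *)
Lemma ae_section_coef n d (I : set LL) (x : LL -> borel_rV R n)
    (u : LL -> borel_rV R d)
    (E : set (lebesgue_plane R * borel_rV R n * borel_rV R d)) :
  measurable I -> measurable_fun I x -> measurable_fun I u -> measurable E ->
  {ae leb, forall t, measurable (I `&` (fun s => (t, s, x s, u s)) @^-1` E)}.
Proof.
move=> mI mx mu' mE.
apply: (@ae_section_prod _ _ (lebesgue_plane R * borel_rV R n)%type
  (borel_rV R d) (fun t s => (t, s, x s, u s)) _ _ mI _ _ mE).
  move=> A mA.
  apply: (@ae_section_prod _ _ (lebesgue_plane R) (borel_rV R n)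
    (fun t s => (t, s, x s)) _ _ mI _ _ mA).
    by move=> B; exact: ae_section_plane.
  by move=> B mB; apply: nearW => t; exact: mx.
by move=> A mA; apply: nearW => t; exact: mu'.
Qed.

Lemma measurable_coord_gt n (i : 'I_n) (r : R) :
  measurable ([set y : 'rV[R]_n | r < y 0 i] : set (borel_rV R n)).
Proof.
apply: sub_sigma_algebra.
apply: (@open_comp _ _ (fun y : 'rV[R]_n => y 0 i) [set z | r < z]) => //.
  by move=> y _; exact: coord_continuous.
Qed.

(** Rational thresholds keep the exceptional null sets of times countable in number when this is
    applied for almost every [t]. *)
Lemma measurable_fun_rat_gt d (X : measurableType d) (D : set X) (h : X -> R) :
  (forall q : rat, measurable (D `&` [set x | ratr q < h x])) ->
  measurable_fun D h.
Proof.
move=> mh mD; apply: (measurability _ (RGenOInfty.measurableE R)) => //.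
move=> _ [_ [r ->] <-].
rewrite (_ : _ `&` _ = \bigcup_(q : rat)
   if r < ratr q then D `&` [set x | ratr q < h x] else set0).
  by apply: bigcupT_measurable_rat => q; case: ifP.
apply/seteqP; split => [x [Dx]|x [q _]]; rewrite /= ?in_itv/= ?andbT.
  move=> /rat_in_itvoo[q]; rewrite in_itv/= => /andP[rq qh].
  by exists q => //; rewrite rq.
case: ifPn => // rq [Dx /= qh]; split => //.
exact: lt_trans rq qh.
Qed.

Lemma ae_measurable_coef n d T (U : set 'rV[R]_d)
    (f : R -> R -> 'rV[R]_n -> 'rV[R]_d -> 'rV[R]_n)
    (x : LL -> borel_rV R n) (u : LL -> borel_rV R d) (i : 'I_n) :
  measurable_coef T U f -> (forall s, 0 <= s <= T -> U (u s)) ->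
  measurable_fun (`[0, T]%classic : set LL) x ->
  measurable_fun (`[0, T]%classic : set LL) u ->
  {ae leb, forall t, 0 <= t <= T ->
    measurable_fun (`[0, t[%classic : set LL) (fun s : LL => f t s (x s) (u s) 0 i)}.
Proof.
move=> mf Uu mx mu'.
have mI := measurable_itv_line `[0, T].
have aeq (q : rat) : {ae leb, forall t, 0 <= t <= T ->
    measurable ((`[0, t[%classic : set LL) `&`
      [set s | ratr q < f t s (x s) (u s) 0 i])}.
  (* [U] need not be measurable, so [E] lives in the ambient space and describes the superlevel set
     only on the domain of the coefficient. That is enough, because all points (t, s, x s, u s) with
     [0 <= s < t] lie in that domain. *)
  have [E mE DE] := mf _ (ex_intro2 _ _ _ (measurable_coord_gt i (ratr q)) erefl).
  apply: ae_imp (ae_section_coef mI mx mu' mE) => t mEt /andP[t0 tT].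
  rewrite (_ : _ `&` _ = (`[0, t[%classic : set LL) `&`
      (`[0, T]%classic `&` (fun s => (t, s, x s, u s)) @^-1` E)).
    by apply: measurableI => //; exact: measurable_itv_line.
  have sT s : 0 <= s < t -> 0 <= s <= T.
    by move=> /andP[-> st]; rewrite (le_trans (ltW st)).
  have Dz s : 0 <= s < t -> Delta T t s /\ U (u s).
    move=> /[dup] sI /andP[s0 st]; split; last exact/Uu/sT.
    by split=> //; rewrite s0 ltW.
  have DEz s : 0 <= s < t -> E (t, s, x s, u s) <-> ratr q < f t s (x s) (u s) 0 i.
    move=> sI; have := congr1 (fun A => A (t, s, x s, u s)) DE.
    rewrite /= => EQ; split => h.
      have : (Delta T t s /\ U (u s)) /\ E (t, s, x s, u s) by split; [exact: Dz|].
      by rewrite EQ => -[].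
    have : (Delta T t s /\ U (u s)) /\ ratr q < f t s (x s) (u s) 0 i.
      by split; [exact: Dz|].
    by rewrite -EQ => -[].
  apply/seteqP; split => s /=; rewrite !in_itv/=.
    by move=> [sI qs]; split=> //; split; [exact: sT|exact/DEz].
  by move=> [sI [_ Es]]; split=> //; exact/DEz.
apply: ae_imp (ae_forall_count aeq) => t mt tT.
by apply: measurable_fun_rat_gt => q; exact: mt.
Qed.

(** Good times accumulate at every [t], and along them the truncated sections converge pointwise at
    each [s] other than [t]; a pointwise limit of measurable functions is measurable. *)
Lemma measurable_section_limit T (h : R -> R -> R) (w : R -> R) : 0 < T ->
  {ae leb, forall t, 0 <= t <= T ->
    measurable_fun (`[0, t[%classic : set LL) (h t : LL -> R)} ->
  (forall e, 0 < e -> exists2 r, 0 < r & forall a, 0 <= a < r -> w a < e) ->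
  (forall t t' s, 0 <= s <= t -> t <= T -> s <= t' -> t' <= T ->
    `|h t s - h t' s| <= w `|t - t'|) ->
  forall t, 0 <= t <= T -> measurable_fun (`[0, T]%classic : set LL)
    (fun s : LL => if s < t then h t s else 0).
Proof.
move=> T0 mh w0 hw t /andP[t0 tT].
have mlt r (D : set LL) : measurable_fun D (fun s : LL => (s : R) < r).
  apply: measurable_funTS; apply: measurable_fun_line => //.
  by apply: measurable_fun_ltr => //; exact: measurable_id.
have mI := measurable_itv_line `[0, T].
have good m : exists t', [/\ 0 <= t' <= T, `|t - t'| < m.+1%:R^-1 &
    measurable_fun (`[0, t'[%classic : set LL) (h t' : LL -> R)].
  have : 0 < m.+1%:R^-1 :> R by rewrite invr_gt0.
  move: (m.+1%:R^-1) => e e0.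
  (* Clipping to [0, T] leaves a nonempty open window even when [t] is an endpoint, because
     [0 < T]. *)
  have ab : Num.max 0 (t - e) < Num.min T (t + e).
    by rewrite gt_max !lt_min T0/=; apply/and3P; split; lra.
  have [t' /andP[]] := ae_itvoo (negligible_lebesgue_line mh) ab.
  rewrite gt_max lt_min => /andP[t'0 tt'] /andP[t'T t't] mt'.
  exists t'; split; last by apply: mt'; rewrite !ltW.
    by rewrite !ltW.
  by rewrite ltr_norml; apply/andP; split; lra.
have [tm tmP] := choice good.
have mD : measurable ((`[0, T]%classic : set LL) `\ t).
  by apply: measurableD => //; rewrite -set_itv1; exact: measurable_itv_line.
pose g m (s : LL) := if s < tm m then h (tm m) s else 0.
pose g0 (s : LL) := if s < t then h t s else 0.
(* The point [t] is removed because the cutoffs [s < tm m] need not converge at [s = t]. *)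
suff mg0 : measurable_fun ((`[0, T]%classic : set LL) `\ t) g0.
  apply: measurable_fun_if => //.
  apply: (@eq_measurable_fun _ _ _ _ _ g0).
    by move=> s /[!inE] -[_ /= st]; rewrite /g0 st.
  apply: measurable_funS mD _ mg0 => s /= [sI st]; split => // ts.
  by move: st; rewrite ts ltxx.
apply: (@measurable_fun_cvg _ _ _ _ g) => [m|s [/= sI st]].
  have [tmT _ mtm] := tmP m.
  apply: (@measurable_funS _ _ _ _ (`[0, T]%classic : set LL)) => //.
  apply: measurable_fun_if => //.
  apply: measurable_funS mtm; first exact: measurable_itv_line.
  by move=> s /= [+ st]; rewrite !in_itv/= => /andP[-> _]; rewrite st.
move: sI; rewrite in_itv/= => /andP[s0 sT].
apply/cvgrPdist_lt => e e0.
have [r r0 wr] := w0 e e0.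
(* Once [tm m] is closer to [t] than [s] is, the tests [s < tm m] and [s < t] agree. *)
have dst : 0 < Num.min r `|t - s|.
  by rewrite lt_min r0 normr_gt0 subr_eq0 eq_sym; apply/eqP.
near=> m.
have [/andP[tm0 tmT] ttm _] := tmP m.
have : `|t - tm m| < Num.min r `|t - s|.
  apply: lt_le_trans ttm _; apply: ltW; near: m.
  exact: (near_infty_natSinv_lt (PosNum dst)).
rewrite lt_min => /andP[ttmr ttms].
rewrite /g0 /g; have [st'|ts] := ltP s t.
  have stm : s < tm m.
    move: ttms; rewrite [`|t - s|]gtr0_norm ?subr_gt0// ltr_norml.
    by move=> /andP[_]; rewrite ltrD2l ltrN2.
  rewrite stm; apply: le_lt_trans (hw _ _ _ _ _ _ _) _ => //.
  - by rewrite s0 ltW.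
  - exact: ltW.
  - by apply: wr; rewrite normr_ge0.
have {}ts : t < s by rewrite lt_neqAle ts andbT; apply/eqP => ts'; apply: st.
rewrite [s < tm m]ltNge (_ : tm m <= s) ?subrr ?normr0//.
move: ttms; rewrite distrC [`|t - s|]distrC [`|s - t|]gtr0_norm ?subr_gt0//.
by rewrite ltr_norml => /andP[_]; rewrite ltrD2r => /ltW.
Unshelve. all: by end_near.
Qed.

End Sections.

(** * Picard iteration *)

Section RowNorm.
Context {R : realType} {n : nat}.
Implicit Types y : 'rV[R]_n.

Lemma coord_le_norm y i : `|y 0 i| <= `|y|.
Proof.
rewrite [leRHS]mx_normrE.
exact: (@le_bigmax _ _ _ 0 (fun ij : 'I_1 * 'I_n => `|y ij.1 ij.2|) (0, i)).
Qed.

Lemma norm_le_coord y c : 0 <= c -> (forall i, `|y 0 i| <= c) -> `|y| <= c.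
Proof.
move=> c0 yc; rewrite [leLHS]mx_normrE; apply: bigmax_le => // -[j i] _ /=.
by rewrite ord1.
Qed.

Lemma coord_le_euclid y i : `|y 0 i| <= euclid_norm y.
Proof.
rewrite -sqrtr_sqr; apply: ler_wsqrtr.
by rewrite (bigD1 i)//= lerDl sumr_ge0// => j _; exact: sqr_ge0.
Qed.

Lemma euclid_ge0 y : 0 <= euclid_norm y.
Proof. exact: sqrtr_ge0. Qed.

Lemma euclid0 : euclid_norm (0 : 'rV[R]_n) = 0.
Proof. by rewrite /euclid_norm big1 ?sqrtr0// => i _; rewrite mxE expr0n. Qed.

Lemma euclid_le_norm y : euclid_norm y <= n%:R * `|y|.
Proof.
have e0 : 0 <= n%:R * `|y| by rewrite mulr_ge0.
rewrite -[leRHS]ger0_norm// -sqrtr_sqr; apply: ler_wsqrtr.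
apply: (@le_trans _ _ (\sum_(i < n) `|y| ^+ 2)).
  apply: ler_sum => i _; rewrite -[y 0 i ^+ 2]real_normK ?num_real//.
  by rewrite lerXn2r ?nnegrE// coord_le_norm.
rewrite sumr_const card_ord -[leLHS]mulr_natl exprMn ler_wpM2r ?sqr_ge0//.
by rewrite -natrX ler_nat -mulnn; case: (n) => // m; exact: leq_pmulr.
Qed.

End RowNorm.

Definition vanishes_at0 {R : realType} (w : R -> R) :=
  forall e, 0 < e -> exists2 r, 0 < r & forall a, 0 <= a < r -> w a < e.

Section Paths.
Context {R : realType} {n : nat} (T : R).
Implicit Types x y : R -> 'rV[R]_n.

Lemma continuous_pathP x : continuous_path T x <->
  forall t, 0 <= t <= T -> forall e, 0 < e -> exists2 r, 0 < r &
    forall t', 0 <= t' <= T -> `|t - t'| < r -> `|x t - x t'| < e.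
Proof.
rewrite /continuous_path subspace_continuousP; split => cx t tT.
  move=> e e0; have /cvgrPdist_lt/(_ e e0) := cx t tT.
  rewrite near_withinE => /nbhs_ballP[r /= r0 rx]; exists r => // t' t'T tt'.
  exact: rx.
apply/cvgrPdist_lt => e e0; rewrite near_withinE.
have [r r0 rx] := cx t tT e e0.
by apply/nbhs_ballP; exists r => // t' tt' t'T; exact: rx.
Qed.

Lemma modulus_continuous_path x (w : R -> R) : vanishes_at0 w ->
  (forall t t', 0 <= t -> t <= t' -> t' <= T -> `|x t' - x t| <= w (t' - t)) ->
  continuous_path T x.
Proof.
move=> w0 xw; apply/continuous_pathP => t /andP[t0 tT] e e0.
have [r r0 wr] := w0 e e0; exists r => // t' /andP[t'0 t'T].
wlog tt' : t t' t0 tT t'0 t'T / t <= t'.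
  move=> W; have [tt'|/ltW t't] := leP t t'; first exact: W.
  by rewrite distrC [`|x t - _|]distrC; exact: W.
rewrite distrC [`|x t - _|]distrC ger0_norm ?subr_ge0// => h.
apply: le_lt_trans (xw _ _ _ _ _) _ => //.
by apply: wr; rewrite subr_ge0 tt'.
Qed.

Lemma continuous_pathD x y : continuous_path T x -> continuous_path T y ->
  continuous_path T (fun t => x t + y t).
Proof. by move=> cx cy t; apply: cvgD; [exact: cx|exact: cy]. Qed.

Lemma continuous_pathB x y : continuous_path T x -> continuous_path T y ->
  continuous_path T (fun t => x t - y t).
Proof. by move=> cx cy t; apply: cvgB; [exact: cx|exact: cy]. Qed.

Lemma continuous_path_bounded x : continuous_path T x ->
  exists2 B, 0 <= B & forall t, 0 <= t <= T -> `|x t| <= B.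
Proof.
move=> cx; have := continuous_compact cx (@segment_compact _ 0 T).
move=> /compact_bounded[M [_ MB]]; exists (`|M| + 1); first by rewrite addr_ge0.
move=> t tT; apply: (MB (`|M| + 1)); last by exists t.
by rewrite (le_lt_trans (ler_norm M))// ltrDl.
Qed.

Lemma continuous_path_measurable x : continuous_path T x ->
  measurable_fun (`[0, T]%classic : set (lebesgue_line R))
    (x : lebesgue_line R -> borel_rV R n).
Proof.
move=> /continuousP cx.
apply: (@measurability _ _ _ _ (`[0, T]%classic : set (lebesgue_line R))
  (x : lebesgue_line R -> borel_rV R n) (@open 'rV[R]_n) erefl).
move=> _ [B oB <-].
apply: sub_caratheodory; apply: open_measurable_subspace => //.
exact: cx.
Qed.

End Paths.

(** * Fixed points of a weighted contraction on continuous paths *)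

Section Picard.
Context {R : realType} {n : nat} (T q W : R) (wgt : R -> R).
Implicit Types x y : R -> 'rV[R]_n.
Variable Phi : (R -> 'rV[R]_n) -> R -> 'rV[R]_n.
Hypotheses (q0 : 0 <= q) (q1 : q < 1).
Hypothesis wgtP : forall t, 0 <= t <= T -> 1 <= wgt t <= W.
Hypothesis Phi_cont : forall x, continuous_path T x -> continuous_path T (Phi x).
(** The weighted norm is never formed: any [c] with this pointwise bound stands for it, which avoids
    building a Banach space of paths. *)
Hypothesis Phi_contr : forall x y c, continuous_path T x -> continuous_path T y ->
  0 <= c -> (forall s, 0 <= s <= T -> `|x s - y s| <= c * wgt s) ->
  forall t, 0 <= t <= T -> `|Phi x t - Phi y t| <= q * c * wgt t.

Let wgt_ge0 t : 0 <= t <= T -> 0 <= wgt t.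
Proof. by move=> /wgtP/andP[w1 _]; exact: le_trans w1. Qed.

Let geometric_lt c e : 0 < e -> \forall m \near \oo, c * q ^+ m < e.
Proof.
move=> e0; have q1' : `|q| < 1 by rewrite ger0_norm.
have : c * q ^+ m @[m --> \oo] --> c * 0.
  by apply: cvgMr; exact: cvg_expr.
by rewrite mulr0 => /cvgr_lt; apply.
Qed.

Lemma path_dist_bounded x y : continuous_path T x -> continuous_path T y ->
  exists2 c, 0 <= c & forall t, 0 <= t <= T -> `|x t - y t| <= c * wgt t.
Proof.
move=> cx cy; have [c c0 xyc] := continuous_path_bounded (continuous_pathB cx cy).
exists c => // t tT; apply: le_trans (xyc _ tT) _.
by rewrite ler_peMr//; case/andP: (wgtP tT).
Qed.

Lemma fixpoint_unique x y : continuous_path T x -> continuous_path T y ->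
  (forall t, 0 <= t <= T -> Phi x t = x t) ->
  (forall t, 0 <= t <= T -> Phi y t = y t) ->
  forall t, 0 <= t <= T -> x t = y t.
Proof.
move=> cx cy fx fy t tT; have [c c0 xyc] := path_dist_bounded cx cy.
have xym m : forall s, 0 <= s <= T -> `|x s - y s| <= c * q ^+ m * wgt s.
  elim: m => [|m IH] s sT; first by rewrite mulr1 xyc.
  rewrite -fx// -fy// exprS mulrCA.
  by apply: Phi_contr => //; rewrite mulr_ge0// exprn_ge0.
apply/eqP; rewrite -subr_eq0 -normr_le0 leNgt; apply/negP => xy0.
have [m _ /(_ m (leqnn m)) /=] := geometric_lt (c * wgt t) xy0.
by rewrite mulrAC ltNge xym.
Qed.

Lemma fixpoint_exists x0 : continuous_path T x0 ->
  exists2 x, continuous_path T x & forall t, 0 <= t <= T -> Phi x t = x t.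
Proof.
move=> cx0; pose X m := iter m Phi x0.
have cX m : continuous_path T (X m) by elim: m => //= m; exact: Phi_cont.
have [c c0 Xc] := path_dist_bounded (cX 1%N) (cX 0%N).
have X1 m t : 0 <= t <= T -> `|X m.+1 t - X m t| <= c * q ^+ m * wgt t.
  elim: m t => [|m IH] t tT; first by rewrite mulr1 Xc.
  rewrite exprS mulrCA; apply: (Phi_contr (cX m.+1) (cX m) _ IH tT).
  by rewrite mulr_ge0// exprn_ge0.
(* D q^m is the sum of the geometric tail c q^m + c q^(m+1) + ...; bounding by differences of such
   tails makes the induction telescope. *)
pose D := c / (1 - q).
have q10 : 0 < 1 - q by rewrite subr_gt0.
have D0 : 0 <= D by rewrite divr_ge0// ltW.
have Dq m : D * q ^+ m = c * q ^+ m + D * q ^+ m.+1.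
  rewrite /D exprS; field; exact: lt0r_neq0.
have Xk m k t : 0 <= t <= T ->
    `|X (m + k)%N t - X m t| <= (D * q ^+ m - D * q ^+ (m + k)) * wgt t.
  move=> tT; elim: k => [|k IH]; first by rewrite addn0 !subrr normr0 mul0r.
  apply: le_trans (ler_distD (X (m + k)%N t) _ _) _.
  rewrite addnS; apply: le_trans (lerD (X1 _ _ tT) IH) _.
  by rewrite -mulrDl (Dq (m + k)%N) ler_wpM2r ?wgt_ge0//; lra.
have XD m k t : 0 <= t <= T -> (m <= k)%N ->
    `|X k t - X m t| <= D * q ^+ m * wgt t.
  move=> tT mk; rewrite -(subnKC mk); apply: le_trans (Xk _ _ _ tT) _.
  by rewrite ler_wpM2r ?wgt_ge0// gerBl mulr_ge0// exprn_ge0.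
have cvX t : 0 <= t <= T -> cvg (X m t @[m --> \oo]).
  move=> tT; apply/cauchy_cvgP; apply: cauchy_exP => e e0.
  have [m _ /(_ m (leqnn m)) /= me] := geometric_lt (D * wgt t) e0.
  exists (X m t); exists m => // k /= mk.
  rewrite -ball_normE /= distrC; apply: le_lt_trans (XD _ _ _ tT mk) _.
  by rewrite mulrAC.
pose x t := lim (X m t @[m --> \oo]).
have xX m t : 0 <= t <= T -> `|x t - X m t| <= D * q ^+ m * wgt t.
  move=> tT.
  have Xx : `|X k t - X m t| @[k --> \oo] --> `|x t - X m t|.
    by apply: cvg_norm; apply: cvgB; [exact: cvX|exact: cvg_cst].
  rewrite -(cvg_lim _ Xx)//; apply: limr_le; first by apply/cvg_ex; eexists; exact: Xx.
  by exists m => // k; exact: XD.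
(* [W] turns the weighted tail bound into a uniform one, and a three-epsilon argument transfers
   continuity from an iterate. *)
have cx : continuous_path T x.
  apply/continuous_pathP => t tT e e0.
  have e30 : 0 < e / 3 by rewrite divr_gt0.
  have [m _ /(_ m (leqnn m)) /= me] := geometric_lt (D * W) e30.
  have xe s : 0 <= s <= T -> `|x s - X m s| < e / 3.
    move=> sT; apply: le_lt_trans (xX m _ sT) (le_lt_trans _ me).
    rewrite mulrAC ler_wpM2r ?exprn_ge0// ler_wpM2l//.
    by case/andP: (wgtP sT).
  have [r r0 Xr] := (continuous_pathP T (X m)).1 (cX m) t tT _ e30.
  exists r => // t' t'T tt'.
  have -> : e = e / 3 + (e / 3 + e / 3) by lra.
  apply: le_lt_trans (ler_distD (X m t) _ _) (ltrD (xe _ tT) _).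
  apply: le_lt_trans (ler_distD (X m t') _ _) (ltrD (Xr _ t'T tt') _).
  by rewrite distrC xe.
exists x => // t tT; apply/eqP.
rewrite -subr_eq0 -normr_le0 leNgt; apply/negP => xy0.
(* Both [Phi x t] and [x t] lie within D q^m wgt(t) of the iterate of index m + 1, the former by
   contraction and the latter by the tail bound; hence the factor 2. *)
have [m _ /(_ m (leqnn m)) /=] := geometric_lt (2 * D * wgt t) xy0.
apply/negP; rewrite -leNgt; apply: le_trans (ler_distD (X m.+1 t) _ _) _.
have -> : 2 * D * wgt t * q ^+ m = D * q ^+ m * wgt t + D * q ^+ m * wgt t by ring.
apply: lerD; last first.
  rewrite distrC; apply: le_trans (xX _ _ tT) _.
  rewrite ler_wpM2r ?wgt_ge0// ler_wpM2l// exprS ler_piMl ?exprn_ge0//.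
  exact: ltW.
apply: le_trans (Phi_contr cx (cX m) _ (xX m) tT) _.
  by rewrite mulr_ge0// exprn_ge0.
rewrite ler_wpM2r ?wgt_ge0// ler_piMl//; last exact: ltW.
by rewrite mulr_ge0// exprn_ge0.
Qed.

End Picard.

(** * The integral operator of a coefficient *)

Section Vanishing.
Context {R : realType}.
Implicit Types (w : R -> R).

Lemma vanishes_at0D w1 w2 (a b : R) : 0 <= a -> 0 <= b ->
  vanishes_at0 w1 -> vanishes_at0 w2 -> vanishes_at0 (fun r => a * w1 r + b * w2 r).
Proof.
move=> a0 b0 h1 h2 e e0.
(* Dividing by [c + 1] instead of [c] also covers a zero coefficient. *)
have lt_half c (z : R) : 0 <= c -> z < e / (2 * (c + 1)) -> c * z < e / 2.
  move=> c0 ze; apply: (@le_lt_trans _ _ (c * (e / (2 * (c + 1))))).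
    by rewrite ler_wpM2l// ltW.
  have -> : c * (e / (2 * (c + 1))) = e / 2 * (c / (c + 1)).
    by field; rewrite gt_eqF// ltr_wpDl.
  by rewrite gtr_pMr ?divr_gt0// ltr_pdivrMr ?mul1r ?ltrDl// ltr_wpDl.
have pos c : 0 <= c -> 0 < e / (2 * (c + 1)).
  by move=> c0; rewrite divr_gt0// mulr_gt0// ltr_wpDl.
have [r1 r10 w1r] := h1 _ (pos _ a0); have [r2 r20 w2r] := h2 _ (pos _ b0).
exists (Num.min r1 r2) => [|r /andP[r0]]; first by rewrite lt_min r10.
rewrite lt_min => /andP[rr1 rr2]; rewrite [e]splitr ltrD//.
  by apply: lt_half => //; apply: w1r; rewrite r0.
by apply: lt_half => //; apply: w2r; rewrite r0.
Qed.

Lemma vanishes_at0_powR (th : R) : 0 < th -> vanishes_at0 (fun r => r `^ th).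
Proof.
move=> th0 e e0; exists (e `^ th^-1); first exact: powR_gt0.
move=> r /andP[r0 re].
have -> : e = (e `^ th^-1) `^ th.
  by rewrite -powRrM mulVf ?gt_eqF// powRr1// ltW.
by rewrite gt0_ltr_powR// nnegrE// ?powR_ge0.
Qed.

Lemma modulus_vanishes_at0 w : modulus_of_continuity w -> vanishes_at0 w.
Proof.
move=> [w_ge0 _ w00 /cvgrPdist_lt cw] e e0.
have := cw e e0; rewrite /at_right near_withinE => /nbhs_ballP[r /= r0 rw].
exists r => // a /andP[]; rewrite le_eqVlt => /predU1P[<-|a0 ar].
  by rewrite w00.
have : `|w 0 - w a| < e.
  by apply: rw => //; rewrite /ball/= sub0r normrN gtr0_norm.
by rewrite w00 sub0r normrN ger0_norm// w_ge0// ltW.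
Qed.

(** The bound 1/4 is chosen so that the two integral operators together contract by 1/2. The summand
    1 in [4 * A + 1] keeps the threshold positive when [A = 0]. *)
Lemma powR_inv_small (A th : R) : 0 <= A -> 0 < th ->
  exists2 l0, 0 < l0 & forall l, l0 <= l -> A * (l `^ th)^-1 <= 4^-1.
Proof.
move=> A0 th0; have A1 : 0 < 4 * A + 1 by rewrite ltr_wpDl// mulr_ge0.
exists ((4 * A + 1) `^ th^-1); first exact: powR_gt0.
move=> l ll; have l0 : 0 < l by apply: lt_le_trans ll; exact: powR_gt0.
rewrite ler_pdivrMr ?powR_gt0//.
have : 4 * A + 1 <= l `^ th.
  have -> : 4 * A + 1 = ((4 * A + 1) `^ th^-1) `^ th.
    by rewrite -powRrM mulVf ?gt_eqF// powRr1// ltW.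
  by rewrite ge0_ler_powR// ?nnegrE ?powR_ge0// ltW.
lra.
Qed.

End Vanishing.

Section Weight.
Context {R : realType}.
Local Notation mu := (@completed_lebesgue_measure R).
Local Notation LL := (lebesgue_line R).

Lemma kern_weight_bound (T k q0 q1 : R) (K0 K1 : R -> R) :
  0 <= T -> 0 <= k -> 1 < q0 -> 1 < q1 -> k < 1 - q0^-1 -> k < 1 - q1^-1 ->
  Lp T q0 K0 -> Lp T q1 K1 ->
  (forall s, 0 <= s <= T -> 0 <= K0 s /\ 0 <= K1 s) ->
  exists th M, [/\ 0 < th <= 1, 0 <= M & forall t, 0 <= t <= T ->
    (\int[mu]_(s in `[0%R, T]) (kern (k + th) t s * (1 + K0 s + K1 s))%:E <= M%:E)%E].
Proof.
move=> T0 k0 q01 q11 kq0 kq1 L0 L1 K_ge0.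
have K0_ge0 s : 0 <= s <= T -> 0 <= K0 s by move=> /K_ge0[].
have K1_ge0 s : 0 <= s <= T -> 0 <= K1 s by move=> /K_ge0[].
have [t0 t00 h0] := kern_Lp_bound T0 k0 q01 kq0 L0 K0_ge0.
have [t1 t10 h1] := kern_Lp_bound T0 k0 q11 kq1 L1 K1_ge0.
have k1 : k < 1.
  by apply: lt_trans kq0 _; rewrite ltrBlDr ltrDl invr_gt0 (lt_trans _ q01).
(* One gain for all three summands of the weight; the constant summand needs [k + th < 1], which the
   bound (1 - k)/2 ensures. *)
pose th := Num.min (Num.min t0 t1) ((1 - k) / 2).
have thP : [/\ 0 < th, th <= t0, th <= t1 & th <= (1 - k) / 2].
  rewrite /th; split; last by rewrite ge_min lexx orbT.
  - by rewrite !lt_min t00 t10 divr_gt0// subr_gt0.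
  - by rewrite !ge_min lexx.
  - by rewrite !ge_min lexx orbT.
case: thP => th0 tht0 tht1 thk.
have [|M0 hM0] := h0 th; first by rewrite th0.
have [|M1 hM1] := h1 th; first by rewrite th0.
pose M := T `^ (1 - (k + th)) / (1 - (k + th)) + M0 + M1.
(* The signs of [M0] and [M1] are unknown, so nonnegativity is imposed. *)
exists th, (Num.max 0 M); split.
- by rewrite th0/=; lra.
- by rewrite le_max lexx.
move=> t tT; apply: (@le_trans _ _ M%:E); last by rewrite lee_fin le_max lexx orbT.
have mI := measurable_itv_line `[0, T].
have mk : measurable_fun (`[0, T]%classic : set LL) (kern (k + th) t : LL -> R).
  exact: measurable_kern_line.
have m0 : measurable_fun (`[0, T]%classic : set LL) (fun s : LL => kern (k + th) t s * K0 s).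
  by apply: measurable_funM; [exact: mk|exact: Lp_measurable L0].
have m1 : measurable_fun (`[0, T]%classic : set LL) (fun s : LL => kern (k + th) t s * K1 s).
  by apply: measurable_funM; [exact: mk|exact: Lp_measurable L1].
under eq_integral do rewrite !mulrDr mulr1 !EFinD.
rewrite (ge0_integralD _ mI); last 4 first.
- by move=> s sI; rewrite -EFinD lee_fin addr_ge0 ?mulr_ge0 ?kern_ge0 ?K0_ge0.
- by apply/measurable_EFinP; apply: measurable_funD; [exact: mk|exact: m0].
- by move=> s sI; rewrite lee_fin mulr_ge0 ?kern_ge0 ?K1_ge0.
- exact/measurable_EFinP.
rewrite /M EFinD leeD ?hM1//.
rewrite (ge0_integralD _ mI); last 4 first.
- by move=> s sI; rewrite lee_fin kern_ge0.
- exact/measurable_EFinP.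
- by move=> s sI; rewrite lee_fin mulr_ge0 ?kern_ge0 ?K0_ge0.
- exact/measurable_EFinP.
rewrite EFinD leeD ?hM0// kern_integral_le//.
by rewrite -ltrBrDl; lra.
Qed.

End Weight.

Section Coefficient.
Context {R : realType} {n d : nat}.
Local Notation mu := (@completed_lebesgue_measure R).
Local Notation LL := (lebesgue_line R).
Variables (T k th M K2 : R) (U : set 'rV[R]_d) (K0 K1 omega : R -> R).
Variables (F : R -> R -> 'rV[R]_n -> 'rV[R]_d -> 'rV[R]_n) (u : R -> 'rV[R]_d).
Hypotheses (T0 : 0 < T) (k01 : 0 <= k <= 1) (th01 : 0 < th <= 1) (M0 : 0 <= M)
  (K20 : 0 <= K2).
Hypothesis omegaP : modulus_of_continuity omega.
Hypothesis K_ge0 : forall s, 0 <= s <= T -> 0 <= K0 s /\ 0 <= K1 s.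
Hypothesis mK0 : measurable_fun (`[0, T]%classic : set LL) (K0 : LL -> R).
Hypothesis mK1 : measurable_fun (`[0, T]%classic : set LL) (K1 : LL -> R).
Let phi s := 1 + K0 s + K1 s.
Hypothesis hM : forall t, 0 <= t <= T ->
  (\int[mu]_(s in `[0%R, T]) (kern (k + th) t s * (1 + K0 s + K1 s))%:E <= M%:E)%E.
Hypothesis mF : measurable_coef T U F.
Hypothesis Uu : forall s, 0 <= s <= T -> U (u s).
Hypothesis mu_u : measurable_fun (`[0, T]%classic : set LL) (u : LL -> borel_rV R d).
Hypothesis F_le : forall t s y v i, Delta T t s -> U v ->
  `|F t s y v 0 i| <= K0 s + K1 s * euclid_norm y.
Hypothesis F_lip : forall t s y y' v, Delta T t s -> U v ->
  euclid_norm (F t s y v - F t s y' v) <= K1 s * euclid_norm (y - y').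
Hypothesis F_mod : forall t t' s y v, Delta T t s -> Delta T t' s -> U v ->
  euclid_norm (F t s y v - F t' s y v) <= K2 * omega `|t - t'| * (1 + euclid_norm y).

Definition coord_along (x : R -> 'rV[R]_n) (i : 'I_n) t s := F t s (x s) (u s) 0 i.

Definition volterra_op (x : R -> 'rV[R]_n) t : 'rV[R]_n :=
  \row_i volterra T k (coord_along x i) t.

Let Delta_lt r s : 0 <= s < r -> r <= T -> Delta T r s.
Proof. by move=> /andP[s0 sr] rT; split => //; rewrite s0 ltW. Qed.

Let inT r s : 0 <= s < r -> r <= T -> 0 <= s <= T.
Proof. by move=> /andP[s0 sr] rT; rewrite s0 (le_trans (ltW sr)). Qed.

Let phi_ge1 s : 0 <= s <= T -> 1 <= phi s.
Proof. by move=> /K_ge0[? ?]; rewrite /phi -addrA lerDl addr_ge0. Qed.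

Let phi_ge0 s : 0 <= s <= T -> 0 <= phi s.
Proof. by move=> /phi_ge1; exact: le_trans. Qed.

Let mphi : measurable_fun (`[0, T]%classic : set LL) (phi : LL -> R).
Proof.
apply: measurable_funD mK1; apply: measurable_funD mK0.
exact: measurable_cst.
Qed.

Let euclid_path x B s : (forall t, 0 <= t <= T -> `|x t| <= B) -> 0 <= s <= T ->
  euclid_norm (x s : 'rV[R]_n) <= n%:R * B.
Proof.
move=> xB sT; apply: le_trans (euclid_le_norm _) _.
by rewrite ler_wpM2l// xB.
Qed.

Let coord_le x B i r s : 0 <= B -> (forall t, 0 <= t <= T -> `|x t| <= B) ->
  0 <= s < r -> r <= T -> `|coord_along x i r s| <= (1 + n%:R * B) * phi s.
Proof.
move=> B0 xB sr rT; have sT := inT sr rT.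
apply: le_trans (F_le _ _ (Delta_lt sr rT) (Uu sT)) _.
have [K0s K1s] := K_ge0 sT.
apply: (@le_trans _ _ (K0 s + K1 s * (n%:R * B))).
  by rewrite lerD2l ler_wpM2l// euclid_path.
have nB : 0 <= n%:R * B by rewrite mulr_ge0.
by rewrite /phi; nra.
Qed.

Let coord_mod x B i t t' s : (forall t, 0 <= t <= T -> `|x t| <= B) ->
  Delta T t s -> Delta T t' s ->
  `|coord_along x i t s - coord_along x i t' s| <=
    K2 * (1 + n%:R * B) * omega `|t - t'|.
Proof.
move=> xB ts t's.
have sT : 0 <= s <= T.
  by case: ts => /andP[-> st]; exact: le_trans.
have := coord_le_euclid (F t s (x s) (u s) - F t' s (x s) (u s)) i.
rewrite !mxE => /le_trans; apply.
apply: le_trans (F_mod _ ts t's (Uu sT)) _.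
rewrite mulrAC ler_wpM2r//; first by case: omegaP => + _ _ _; apply.
by rewrite ler_wpM2l// lerD2l euclid_path.
Qed.

Let coord_measurable x i t : continuous_path T x -> 0 <= t <= T ->
  measurable_fun (`[0, T]%classic : set LL)
    (fun s : LL => if s < t then coord_along x i t s else 0).
Proof.
move=> cx; have [B B0 xB] := continuous_path_bounded cx.
have mx := continuous_path_measurable cx.
apply: (@measurable_section_limit _ _ (coord_along x i)
  (* The zero summand only gives the modulus the two-term shape of [vanishes_at0D]. *)
  (fun a => K2 * (1 + n%:R * B) * omega a + 0 * omega a)) => //.
- exact: ae_measurable_coef mF Uu mx mu_u.
- apply: vanishes_at0D => //; try exact: modulus_vanishes_at0.
  by rewrite mulr_ge0// addr_ge0// mulr_ge0.
- move=> r r' s sr rT sr' r'T; rewrite mul0r addr0.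
  apply: coord_mod => //; split => //.
  by case/andP: sr => ->.
Qed.

Lemma continuous_volterra_op x : continuous_path T x -> continuous_path T (volterra_op x).
Proof.
move=> cx; have [B B0 xB] := continuous_path_bounded cx.
set c := 1 + n%:R * B.
have c0 : 0 <= c by rewrite addr_ge0// mulr_ge0.
have Tth : 0 <= T `^ th by exact: powR_ge0.
apply: (@modulus_continuous_path _ _ _ _
  (fun r => 2 * c * M * r `^ th + T `^ th * (K2 * c) * M * omega r)).
  apply: vanishes_at0D; rewrite ?mulr_ge0//.
    by apply: vanishes_at0_powR; case/andP: th01.
  exact: modulus_vanishes_at0.
move=> t t' t0 tt' t'T.
have w0 : 0 <= omega (t' - t) by case: omegaP => + _ _ _; apply; rewrite subr_ge0.
have r0 := powR_ge0 (t' - t) th.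
apply: norm_le_coord => [|i].
  by rewrite addr_ge0// !mulr_ge0.
rewrite !mxE.
have := @volterra_increment_le _ T k th M phi k01 th01 mphi phi_ge0 hM
  t t' c (K2 * c * omega (t' - t)) (coord_along x i) t0 tt' t'T c0.
have b0 : 0 <= K2 * c * omega (t' - t) by rewrite !mulr_ge0.
move=> /(_ b0 _ _ _)/le_trans; apply.
- by move=> r rT; exact: coord_measurable.
- by move=> r s sr rT; exact: coord_le.
- move=> s st; have st' : 0 <= s < t'.
    by case/andP: st => -> /lt_le_trans; apply.
  (* The time modulus carries no weight in [s]; [phi >= 1] supplies one. *)
  apply: (@le_trans _ _ (K2 * c * omega (t' - t))); last first.
    by rewrite ler_peMr// phi_ge1// (inT st').
  rewrite -[t' - t]ger0_norm ?subr_ge0//; apply: coord_mod => //.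
    exact: Delta_lt.
  by apply: Delta_lt => //; exact: le_trans t'T.
- by rewrite le_eqVlt; apply/orP; left; apply/eqP; ring.
Qed.

(** The factor [n] arises because the Lipschitz condition is Euclidean while paths are measured in
    the sup norm of row vectors. *)
Lemma volterra_op_contraction x y (c l : R) : continuous_path T x ->
  continuous_path T y -> 0 <= c -> 0 < l ->
  (forall s, 0 <= s <= T -> `|x s - y s| <= c * expR (l * s)) ->
  forall t, 0 <= t <= T -> `|volterra_op x t - volterra_op y t| <=
    n%:R * M * (l `^ th)^-1 * c * expR (l * t).
Proof.
move=> cx cy c0 l0 xy t tT.
have [B B0 xB] := continuous_path_bounded cx.
have [B' B'0 yB] := continuous_path_bounded cy.
have e0 := expR_ge0 (l * t); have l0' : 0 <= (l `^ th)^-1 by rewrite invr_ge0 powR_ge0.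
have tT' : t <= T by case/andP: tT.
apply: norm_le_coord => [|i]; first by rewrite !mulr_ge0.
(* [B + B'] bounds both paths, which gives a growth constant common to the two integrands. *)
have c'0 : 0 <= 1 + n%:R * (B + B') by rewrite addr_ge0// mulr_ge0// addr_ge0.
rewrite !mxE.
have := @volterra_contraction _ T k th M phi th01 mphi phi_ge0 hM l t
  (n%:R * c) (1 + n%:R * (B + B')) (coord_along x i) (coord_along y i) tT _ c'0 l0.
move=> /(_ _ _ _ _ _ _)/le_trans; apply.
- by rewrite mulr_ge0.
- exact: coord_measurable.
- exact: coord_measurable.
- move=> s st; apply: coord_le => //; first by rewrite addr_ge0.
  by move=> r rT; rewrite (le_trans (xB _ rT))// lerDl.
- move=> s st; apply: coord_le => //; first by rewrite addr_ge0.
  by move=> r rT; rewrite (le_trans (yB _ rT))// lerDr.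
- move=> s st; have sT := inT st tT'.
  have := coord_le_euclid (F t s (x s) (u s) - F t s (y s) (u s)) i.
  rewrite !mxE => /le_trans; apply.
  apply: le_trans (F_lip _ _ (Delta_lt st tT') (Uu sT)) _.
  have [K0s K1s] := K_ge0 sT.
  rewrite mulrC; apply: ler_pM => //; first exact: euclid_ge0.
    apply: le_trans (euclid_le_norm _) _.
    by rewrite -mulrA ler_wpM2l// xy.
  by rewrite /phi lerDr addr_ge0.
- by rewrite le_eqVlt; apply/orP; left; apply/eqP; ring.
Qed.

(* Both integrands agree except at [s = t], where [((t - s) `^ k)^-1] is [0] or,
   for [k = 0], [1], and [kern] is [0]. *)
Lemma volterra_opE x t : continuous_path T x -> 0 <= t <= T ->
  let G s := ((t - s) `^ k)^-1 *: F t s (x s) (u s) in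
  vintegrable `[0, t] G /\ vintegral `[0, t] G = volterra_op x t.
Proof.
move=> cx tT G.
have [B B0 xB] := continuous_path_bounded cx.
have [t0 tT'] : 0 <= t /\ t <= T by case/andP: tT.
have mIt := measurable_itv_line `[0, t].
have mIT := measurable_itv_line `[0, T].
have m1 : measurable ([set t] : set LL).
  by rewrite -set_itv1; exact: measurable_itv_line.
have mu1 : mu ([set t] : set LL) = 0%E.
  by rewrite (_ : mu _ = lebesgue_measure [set t])// lebesgue_measure_set1.
have main i : mu.-integrable (`[0, t]%classic : set LL) (fun s => (G s 0 i)%:E) /\
    \int[mu]_(s in `[0, t]) G s 0 i = volterra T k (coord_along x i) t.
  pose G' (s : LL) := kern k t s * coord_along x i t s.
  (* Writing the discrepancy as a multiple of the indicator of a null point gives an identity on all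
     of [0, t], so integrability and the integral follow by linearity. *)
  have GE (s : LL) : `[0, t]%classic s -> G s 0 i = G' s + G t 0 i * \1_[set t] s.
    rewrite /= in_itv/= indicE => /andP[s0]; have [->|st] := eqVneq s t.
      by rewrite mem_set// mulr1 /G' /kern ltxx mul0r add0r.
    rewrite le_eqVlt (negbTE st)/= => stlt.
    rewrite memNset; last by move=> /= st'; move: st; rewrite st' eqxx.
    by rewrite mulr0 addr0 /G' /kern stlt /G mxE.
  have iG'T : mu.-integrable (`[0, T]%classic : set LL) (EFin \o G').
    have c0 : 0 <= 1 + n%:R * B by rewrite addr_ge0// mulr_ge0.
    apply: (kern_mul_integrable th01 mphi phi_ge0 hM tT c0).
      exact: coord_measurable.
    by move=> s st; exact: coord_le.
  have sub : (`[0, t]%classic : set LL) `<=` `[0, T]%classic.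
    by move=> s; rewrite /= !in_itv/= => /andP[-> st]; exact: le_trans tT'.
  have iG' := integrableS mIT mIt sub iG'T.
  have ind0 : (\int[mu]_(s in `[0%R, t]) (\1_([set t] : set LL) s)%:E = 0)%E.
    rewrite integral_indic// setIidl// => _ ->.
    by rewrite /= in_itv/= t0 lexx.
  have iind : mu.-integrable (`[0, t]%classic : set LL)
      (EFin \o (\1_([set t] : set LL) : LL -> R)).
    have mind : measurable_fun (`[0, t]%classic : set LL)
      (\1_([set t] : set LL) : LL -> R) by exact: measurable_indic.
    have ind_ge0 (s : LL) : (`[0, t]%classic : set LL) s ->
      0 <= \1_([set t] : set LL) s :> R by [].
    apply: (@integrable_ge0_le _ _ _ mu _ _ 0 mind ind_ge0).
    by rewrite ind0.
  have iZ := integrableZl mIt (G t 0 i) iind.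
  split.
    apply: eq_integrable (integrableD mIt iG' iZ) => // s /[!inE] sI.
    by rewrite (GE s sI).
  rewrite (@eq_Rintegral _ _ _ mu _ (fun s => G' s + G t 0 i * \1_([set t] : set LL) s)).
    rewrite RintegralD//.
    rewrite RintegralZl// [X in _ + _ * X]/Rintegral ind0 /= mulr0 addr0.
    rewrite /volterra [LHS]Rintegral_mkcond [RHS]Rintegral_mkcond.
    apply: eq_Rintegral => s _; rewrite /patch !mem_setE !in_itv/=.
    have [st|ts] := ltP s t.
      by rewrite (ltW st) (le_trans (ltW st) tT').
    have G'0 : G' s = 0 by rewrite /G' /kern ltNge ts mul0r.
    by move: G'0; rewrite /G' => ->; rewrite !if_same.
  by move=> s /[!inE] sI; rewrite GE.
split=> [i|]; first exact: (main i).1.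
by apply/rowP => i; rewrite !mxE (main i).2.
Qed.

End Coefficient.

Section AeEquality.
Context {R : realType} {n : nat}.
Local Notation mu := (@completed_lebesgue_measure R).

(** If the paths differed at [t], continuity would keep them apart on a window of [0, T] near [t],
    and every such window meets the set of full measure. *)
Lemma ae_eq_continuous_path (T : R) (x y : R -> 'rV[R]_n) : 0 < T ->
  continuous_path T x -> continuous_path T y ->
  {ae mu, forall t, 0 <= t <= T -> x t = y t} ->
  forall t, 0 <= t <= T -> x t = y t.
Proof.
move=> T0 cx cy aexy t /[dup] tT /andP[t0 t1].
apply/eqP; rewrite -subr_eq0 -normr_le0 leNgt; apply/negP => xy0.
have [r r0 h] := (continuous_pathP T _).1 (continuous_pathB cx cy) t tT _ xy0.
have ab : Num.max 0 (t - r) < Num.min T (t + r).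
  by rewrite gt_max !lt_min T0/=; apply/and3P; split; lra.
have [s /andP[]] := ae_itvoo aexy ab.
rewrite gt_max lt_min => /andP[s0 ts] /andP[sT st] xys.
have sT' : 0 <= s <= T by rewrite !ltW.
have ts' : `|t - s| < r by rewrite ltr_norml; apply/andP; split; lra.
by have := h s sT' ts'; rewrite (xys sT') subrr subr0 ltxx.
Qed.

End AeEquality.

Theorem lemmaB2 (R : realType) (n d : nat) (T alpha p : R)
    (U : set 'rV[R]_d) (rho : 'rV[R]_d -> 'rV[R]_d -> R) (u0 : 'rV[R]_d)
    (f g : R -> R -> 'rV[R]_n -> 'rV[R]_d -> 'rV[R]_n)
    (u : R -> 'rV[R]_d) (x0 : R -> 'rV[R]_n)
    (T_gt0 : 0 < T) (alpha_in : 0 < alpha < 1) (p_gt : 1 / alpha < p)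
    (U_u0 : U u0)
    (f_meas : measurable_coef T U f) (g_meas : measurable_coef T U g)
    (hA1 : A1 U rho) (hA2 : A2 T U f g) (hA3 : A3 T U rho alpha p f g)
    (hA4 : A4 T U f g)
    (u_control : control T U rho u0 p u) (x0_cont : continuous_path T x0) :
  exists x : R -> 'rV[R]_n,
    [/\ continuous_path T x, solution T alpha f g x0 u x &
        forall y : R -> 'rV[R]_n,
          continuous_path T y -> solution T alpha f g x0 u y ->
          forall t, 0 <= t <= T -> y t = x t].

Proof.
have [alpha0 alpha1] : 0 < alpha /\ alpha < 1 by case/andP: alpha_in.
have quarters : 4^-1 + 4^-1 <= 2^-1 :> R by lra.
have [rho_euclid _] := hA1.
have [K2 [omega [K20 omegaP hmod]]] := hA2.
have [K0 [K [K_ge0 [q0 q0_gt LK0] [q1 q1_gt LK1] hlip hgrowth]]] := hA3.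
have [Uu mu_u _] := u_control.
have rho0 v : U v -> rho v v = 0.
  by move=> Uv; rewrite rho_euclid// subrr euclid0.
have ia1 : 1 < 1 / alpha by rewrite ltr_pdivlMr// mul1r.
have ap1 : 0 < alpha * p - 1.
  by rewrite subr_gt0 mulrC -ltr_pdivrMr.
(* The inequality 1/alpha <= p / (alpha p - 1) amounts to p - 1/alpha <= p. *)
have q1_gt' : 1 / alpha < q1.
  apply: le_lt_trans q1_gt; rewrite ler_pdivlMr// div1r mulrBr mulr1 mulrA.
  by rewrite mulVf ?gt_eqF// mul1r gerBl invr_ge0 ltW.
have small q : 1 / alpha < q -> [/\ 1 < q, 1 - alpha < 1 - q^-1 & 0 < 1 - q^-1].
  move=> aq; have q1' := lt_trans ia1 aq; split => //.
    rewrite ltrD2l ltrN2 invf_plt ?posrE//; first by rewrite -div1r.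
    exact: lt_trans q1'.
  by rewrite subr_gt0 invf_lt1// (lt_trans _ q1').
have [q01 kq0 iq0] := small _ q0_gt; have [q11 kq1 iq1] := small _ q1_gt'.
have mK0 := Lp_measurable LK0; have mK1 := Lp_measurable LK1.
have k0 : 0 <= 1 - alpha by rewrite subr_ge0 ltW.
have T0 := ltW T_gt0.
have [th1 [M1 [th1P M10 hM1]]] :=
  kern_weight_bound T0 k0 q01 q11 kq0 kq1 LK0 LK1 K_ge0.
(* The regular term is the case [k = 0], with its own gain; the exponent condition becomes 0 < 1 -
   1/q. *)
have [th2 [M2 [th2P M20 hM2]]] :=
  kern_weight_bound T0 (lexx 0) q01 q11 iq0 iq1 LK0 LK1 K_ge0.
have k1P : 0 <= 1 - alpha <= 1 by rewrite k0 gerBl ltW.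
have k2P : 0 <= (0 : R) <= 1 by rewrite lexx ler01.
have e_ge0 (y : 'rV[R]_n) : 0 <= euclid_norm y := euclid_ge0 y.
have F_le (F : R -> R -> 'rV[R]_n -> 'rV[R]_d -> 'rV[R]_n) :
    (forall t s y y' v, Delta T t s -> U v ->
      euclid_norm (F t s y v - F t s y' v) <= K s * euclid_norm (y - y')) ->
    (forall t s v, Delta T t s -> U v -> euclid_norm (F t s 0 v) <= K0 s) ->
    forall t s y v i, Delta T t s -> U v ->
      `|F t s y v 0 i| <= K0 s + K s * euclid_norm y.
  move=> Flip F0 t s y v i ts Uv.
  have -> : F t s y v 0 i = F t s 0 v 0 i + (F t s y v - F t s 0 v) 0 i.
    by rewrite !mxE; ring.
  apply: le_trans (ler_normD _ _) (lerD _ _); apply: le_trans (coord_le_euclid _ _) _.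
    exact: F0.
  by apply: le_trans (Flip _ _ _ _ _ ts Uv) _; rewrite subr0.
have f_lip t s y y' v : Delta T t s -> U v ->
    euclid_norm (f t s y v - f t s y' v) <= K s * euclid_norm (y - y').
  move=> ts Uv; have := hlip t s y y' v v ts Uv Uv; rewrite rho0// addr0.
  by apply: le_trans; rewrite lerDl.
have g_lip t s y y' v : Delta T t s -> U v ->
    euclid_norm (g t s y v - g t s y' v) <= K s * euclid_norm (y - y').
  move=> ts Uv; have := hlip t s y y' v v ts Uv Uv; rewrite rho0// addr0.
  by apply: le_trans; rewrite lerDr.
have f_le := F_le f f_lip (fun t s v ts Uv =>
  le_trans (ler_wpDr (e_ge0 _) (lexx _)) (hgrowth t s v ts Uv)).
have g_le := F_le g g_lip (fun t s v ts Uv =>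
  le_trans (ler_wpDl (e_ge0 _) (lexx _)) (hgrowth t s v ts Uv)).
have f_mod t t' s y v : Delta T t s -> Delta T t' s -> U v ->
    euclid_norm (f t s y v - f t' s y v) <=
      K2 * omega `|t - t'| * (1 + euclid_norm y).
  move=> ts ts' Uv; apply: le_trans (hmod t t' s y v ts ts' Uv).
  by rewrite lerDl.
have g_mod t t' s y v : Delta T t s -> Delta T t' s -> U v ->
    euclid_norm (g t s y v - g t' s y v) <=
      K2 * omega `|t - t'| * (1 + euclid_norm y).
  move=> ts ts' Uv; apply: le_trans (hmod t t' s y v ts ts' Uv).
  by rewrite lerDr.
pose Vf := volterra_op T (1 - alpha) f u; pose Vg := volterra_op T 0 g u.
pose Phi (x : R -> 'rV[R]_n) t := x0 t + Vf x t + Vg x t.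
have cVf x : continuous_path T x -> continuous_path T (Vf x).
  exact: (continuous_volterra_op T_gt0 k1P th1P M10 K20 omegaP K_ge0 mK0 mK1 hM1
    f_meas Uu mu_u f_le f_mod).
have cVg x : continuous_path T x -> continuous_path T (Vg x).
  exact: (continuous_volterra_op T_gt0 k2P th2P M20 K20 omegaP K_ge0 mK0 mK1 hM2
    g_meas Uu mu_u g_le g_mod).
have VfE x t := volterra_opE T_gt0 th1P K20 omegaP K_ge0 mK0 mK1 hM1
    f_meas Uu mu_u f_le f_mod (x := x) (t := t).
have VgE x t := volterra_opE T_gt0 th2P K20 omegaP K_ge0 mK0 mK1 hM2
    g_meas Uu mu_u g_le g_mod (x := x) (t := t).
have Phi_cont x : continuous_path T x -> continuous_path T (Phi x).
  move=> cx; apply: continuous_pathD (cVg _ cx).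
  exact: continuous_pathD x0_cont (cVf _ cx).
have gE x t : continuous_path T x -> 0 <= t <= T ->
    let G s := g t s (x s) (u s) in
    vintegrable `[0, t] G /\ vintegral `[0, t] G = Vg x t.
  move=> cx tT G; have := VgE x t cx tT.
  (* A power with exponent 0 is 1 even for base 0, so the kernel factor disappears also at
     [s = t]. *)
  rewrite (_ : (fun s => _) = G)//.
  by apply/funext => s; rewrite powRr0 invr1 scale1r.
have solE x : continuous_path T x ->
    solution T alpha f g x0 u x <->
    {ae completed_lebesgue_measure, forall t, 0 <= t <= T -> x t = Phi x t}.
  move=> cx; split; apply: ae_imp => t xt tT.
    have [_ _ ->] := xt tT.
    by rewrite /Phi -(gE x t cx tT).2 /Vf -(VfE x t cx tT).2.
  have [i1 e1] := VfE x t cx tT; have [i2 e2] := gE x t cx tT.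
  by split => //; rewrite e1 e2; exact: xt.
have th10 : 0 < th1 by case/andP: th1P.
have th20 : 0 < th2 by case/andP: th2P.
have A10 : 0 <= n%:R * M1 by rewrite mulr_ge0.
have A20 : 0 <= n%:R * M2 by rewrite mulr_ge0.
have [l1 l10 hl1] := powR_inv_small A10 th10.
have [l2 l20 hl2] := powR_inv_small A20 th20.
(* One rate serves both operators: past both thresholds each contributes at most 1/4. *)
pose l := Num.max l1 l2.
have l0 : 0 < l by rewrite lt_max l10.
have Phi_contr x y c : continuous_path T x -> continuous_path T y -> 0 <= c ->
    (forall s, 0 <= s <= T -> `|x s - y s| <= c * expR (l * s)) ->
    forall t, 0 <= t <= T -> `|Phi x t - Phi y t| <= 2^-1 * c * expR (l * t).
  move=> cx cy c0 xy t tT.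
  have := volterra_op_contraction T_gt0 th1P M10 K20 omegaP K_ge0 mK0 mK1 hM1
    f_meas Uu mu_u f_le f_lip f_mod cx cy c0 l0 xy tT.
  have := volterra_op_contraction T_gt0 th2P M20 K20 omegaP K_ge0 mK0 mK1 hM2
    g_meas Uu mu_u g_le g_lip g_mod cx cy c0 l0 xy tT.
  have := hl1 l; rewrite le_max lexx => /(_ isT) hl1'.
  have := hl2 l; rewrite le_max lexx orbT => /(_ isT) hl2'.
  rewrite -/(Vf) -/(Vg) => hg hf.
  have -> : Phi x t - Phi y t = (Vf x t - Vf y t) + (Vg x t - Vg y t).
    by rewrite /Phi; apply/rowP => i; rewrite !mxE; ring.
  apply: le_trans (ler_normD _ _) _; apply: le_trans (lerD hf hg) _.
  have := expR_ge0 (l * t); move: (expR _) => e e0.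
  rewrite -!mulrDl !ler_wpM2r//.
  exact: le_trans (lerD hl1' hl2') quarters.
have half0 : 0 <= 2^-1 :> R by rewrite invr_ge0.
have half1 : 2^-1 < 1 :> R by rewrite invf_lt1// ltr1n.
have wgtP t : 0 <= t <= T -> 1 <= expR (l * t) <= expR (l * T).
  move=> /andP[t0 tT]; rewrite -[X in X <= _]expR0 !ler_expR mulr_ge0 ?(ltW l0)//=.
  by rewrite ler_wpM2l// ltW.
have [x cx fx] := fixpoint_exists half0 half1 wgtP Phi_cont Phi_contr x0_cont.
exists x; split => //.
  by apply/solE => //; apply: nearW => t tT; rewrite fx.
move=> y cy /(solE y cy) aey t tT.
have fy := ae_eq_continuous_path T_gt0 cy (Phi_cont _ cy) aey.
apply: (fixpoint_unique half0 half1 wgtP Phi_contr cy cx) => // s sT.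
by rewrite -fy.
Qed.
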